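(* Let $I\subset\mathbb R$ be an open interval. There exists a constant $C$ independent of $h$ and $E$ such that if $$(L/2)^2\ge(1+C\lambda_1)(1+|t|^2),\qquad \lambda_1\le|t|\le1,\qquad\text{for all }E\in I,$$ then $I$ is in a gap of the Harper operator. Here $\lambda_1=\lambda^{1/h}$, $t=t(E)$ is the coefficient of the monodromy matrix of the Harper equation and $L=L(E)$ is the zeroth Fourier coefficient of the trace of this matrix (both defined in the context).
   Context: Let $0<h<1$, $\lambda>0$. The Harper operator acts in $L^2(\mathbb R)$ by $H\psi(x)=\psi(x+h)+\psi(x-h)+2\lambda\cos(2\pi x)\psi(x)$. An interval is in a gap of the operator if it is contained in an open interval of $\mathbb R$ free of spectrum of the operator. The coefficients $s,t$ and $L$: let $z=x+iy$, $\xi=\frac1{2\pi}\ln\lambda$, $\lambda_1=\lambda^{1/h}$. The Harper equation is $\psi(z+h)+\psi(z-h)+2\lambda\cos(2\pi z)\psi(z)=E\psi(z)$, and the Wronskian is $\{f(z),g(z)\}=f(z+h)g(z)-f(z)g(z+h)$. For $Y_1>0$ sufficiently large, $u_\pm$ are solutions of the Harper equation, analytic in $\{y>Y_1\}$, with $u_\pm(z)=\exp\left(\pm\frac{i\pi}{h}(z-\frac12+i\xi)^2+i\pi z+o(1)\right)$ as $y\to+\infty$, $\{u_+,u_-\}=\lambda$, and such that the ratios $u_\pm(z+1)/u_\pm(z)$ are $h$-periodic. Put $d_\pm(z)=-u_\pm(1-z)$ for $y<-Y_1$. Any entire solution $\psi$ can be written as $\psi=Au_++Bu_-$ for $y>Y_1$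 and $\psi=Cd_++Dd_-$ for $y<-Y_1$, with $A,B,C,D$ analytic and $h$-periodic. It is called minimal if $A,B,C,D$ are bounded and one of them tends to zero as $y$ tends to $+\infty$ or $-\infty$. Let $\psi_D$ be the minimal entire solution for which $D(z)\to0$ and $C(z)\to1$ as $y\to-\infty$; for it set $A_D=\lim_{y\to+\infty}A(z)$, $B_D=\lim_{y\to+\infty}B(z)$, $D_D=\lim_{y\to-\infty}e^{2\pi iz/h}D(z)$. Let $\psi_B(z)=\psi_D(1-z)$. It is known that these solutions exist, that they, their asymptotic coefficients and their ($z$-independent) Wronskian are nontrivial meromorphic functions of $E$, and that the monodromy matrix $\mathcal M$ defined by $\Psi(x+1)=\mathcal M(x/h)\Psi(x)$, $\Psi=(\psi_D,\psi_B)^{T}$, is $$\mathcal M(x)=\begin{pmatrix} a-2\lambda_1\cos(2\pi x)& s+t\,e^{-2\pi ix}\\ -s-t\,e^{2\pi ix}& st/\lambda_1\end{pmatrix},\qquad a=\lambda_1\frac{1-s^2-t^2}{st},$$ with $s=-\lambda_1D_D/B_D$, $t=-\lambda_1A_D$. The zeroth Fourier coefficient of its trace is $L=a+st/\lambda_1$. *)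

(* Defs.v *)
From HB Require Import structures.
From mathcomp Require Import all_boot all_order all_algebra.
From mathcomp Require Import all_classical all_reals all_analysis.
From mathcomp Require Import complex.

Set Implicit Arguments.
Unset Strict Implicit.
Unset Printing Implicit Defensive.

Import Order.TTheory GRing.Theory Num.Theory.
Import numFieldNormedType.Exports.

Local Open Scope classical_set_scope.
Local Open Scope ring_scope.
Local Open Scope complex_scope.

Section ComplexFunctions.
Context {R : realType}.
Local Notation C := R[i].
Local Notation Re := (@complex.Re R).
Local Notation Im := (@complex.Im R).
Local Notation "'i" := (@Complex R 0 1).

Definition cexp (z : C) : C :=
  (expR (Re z))%:C * (cos (Im z) +i* sin (Im z)).

Definition ccos (z : C) : C := (cexp ('i * z) + cexp (- ('i * z))) / 2.

Definition holomorphic_at (f : C -> C) (z : C) : Prop :=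
  derivable (f : C^o -> C^o) z 1.

Definition upper (Y : R) : set C := [set z | Y < Im z].
Definition lower (Y : R) : set C := [set z | Im z < Y].

Definition holomorphic_on (D : set C) (f : C -> C) : Prop :=
  forall z, D z -> holomorphic_at f z.

Definition periodic_on (D : set C) (h : R) (f : C -> C) : Prop :=
  forall z, D z -> f (z + h%:C) = f z.

Definition bounded_on (D : set C) (f : C -> C) : Prop :=
  exists K : R, forall z, D z -> `|f z| <= K%:C.

(* Limits as y = Im z tends to +oo or -oo, uniformly for x = Re z in compact
   sets.  For h-periodic f this is uniformity on the whole horizontal line. *)
Definition lim_up (f : C -> C) (l : C) : Prop :=
  forall K e : R, 0 < e -> \forall y \near +oo,
    forall x : R, `|x| <= K -> `|f (x +i* y) - l| < e%:C.

Definition lim_down (f : C -> C) (l : C) : Prop :=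
  forall K e : R, 0 < e -> \forall y \near -oo,
    forall x : R, `|x| <= K -> `|f (x +i* y) - l| < e%:C.

(* Meromorphic functions are total functions whose values at the poles (and
   possibly at other isolated points) carry no information; [mero_value f p v]
   says that p is not a pole and that v is the value of f there, removable
   singularities being removed. *)
Definition meromorphic (f : C -> C) : Prop :=
  forall p : C, exists (n : nat) (g : C -> C),
    (\forall w \near (p : C^o), holomorphic_at g w) /\
    (\forall w \near (p : C^o)^', (w - p) ^+ n * f w = g w).

Definition mero_value (f : C -> C) (p v : C) : Prop :=
  (f : C^o -> C^o) w @[w --> (p : C^o)^'] --> (v : C^o).

(* P holds off a closed discrete subset of the complex plane. *)
Definition generically (P : C -> Prop) : Prop :=
  forall p : C, \forall w \near (p : C^o)^', P w.

Definition fourier0 (f : R -> C) : C :=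
  (\int[lebesgue_measure]_(x in `[0, 1]) Re (f x)) +i*
  (\int[lebesgue_measure]_(x in `[0, 1]) Im (f x)).

End ComplexFunctions.

Section HarperOperator.
Context {R : realType}.
Local Notation C := R[i].
Local Notation Re := (@complex.Re R).
Local Notation Im := (@complex.Im R).
Local Notation "'i" := (@Complex R 0 1).
Local Notation mu := (@lebesgue_measure R).

(* L^2(R; C) is handled through its representatives: all statements below
   are about functions modulo equality almost everywhere. *)
Definition normL2 (f : R -> C) : \bar R :=
  'N[mu]_2%:E[EFin \o (fun x => Re `|f x|)].

Definition inL2 (f : R -> C) : Prop :=
  [/\ measurable_fun setT (fun x => Re (f x)),
      measurable_fun setT (fun x => Im (f x)) &
      (normL2 f < +oo)%E].

(* E is in the resolvent set of an operator T on L^2(R) when T - E is a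
   bijection of L^2(R) whose inverse is bounded. *)
Definition resolvent_set (T : (R -> C) -> (R -> C)) : set C :=
  [set E | exists K : R, forall g, inL2 g -> exists f,
    [/\ inL2 f,
        {ae mu, forall x, T f x - E * f x = g x},
        (normL2 f <= K%:E * normL2 g)%E &
        forall f', inL2 f' -> {ae mu, forall x, T f' x - E * f' x = g x} ->
          {ae mu, forall x, f' x = f x}]].

Definition spectrum (T : (R -> C) -> (R -> C)) : set C := ~` resolvent_set T.

Definition harper_op (lambda h : R) (psi : R -> C) : R -> C :=
  fun x => psi (x + h) + psi (x - h) + (2 * lambda * cos (2 * pi * x))%:C * psi x.

Definition open_interval (J : set R) : Prop := open J /\ is_interval J.

Definition in_gap (T : (R -> C) -> (R -> C)) (I : set R) : Prop :=
  exists J : set R, [/\ open_interval J, I `<=` J &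
    forall E : R, J E -> ~ spectrum T E%:C].

End HarperOperator.

Section Monodromy.
Context {R : realType}.
Local Notation C := R[i].
Local Notation Re := (@complex.Re R).
Local Notation Im := (@complex.Im R).
Local Notation "'i" := (@Complex R 0 1).
Variables (lambda h : R).

Definition xi : R := ln lambda / (2 * pi).
Definition lambda1 : R := lambda `^ h^-1.

Definition harper_eq_on (D : set C) (E : C) (psi : C -> C) : Prop :=
  forall z, D z ->
    psi (z + h%:C) + psi (z - h%:C) + (2 * lambda)%:C * ccos ((2 * pi)%:C * z) * psi z
    = E * psi z.

Definition wronskian (f g : C -> C) (z : C) : C :=
  f (z + h%:C) * g z - f z * g (z + h%:C).

(* The canonical solutions u_+ (sg = 1) and u_- (sg = -1). *)
Definition canonical_solution (sg : C) (E : C) (Y : R) (u : C -> C) : Prop :=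
  [/\ holomorphic_on (upper Y) u,
      harper_eq_on (upper Y) E u,
      exists2 r : C -> C, lim_up r 0 &
        forall z, upper Y z ->
          u z = cexp (sg * ('i * (pi / h)%:C) * (z - 2^-1 + 'i * xi%:C) ^+ 2
                      + 'i * pi%:C * z + r z) &
      periodic_on (upper Y) h (fun z => u (z + 1) / u z)].

(* psi is an entire solution with D -> 0 and C -> 1 as y -> -oo; AD, BD and DD
   are its asymptotic coefficients. *)
Definition minimal_solution_D (E : C) (psi : C -> C) (AD BD DD : C) : Prop :=
  [/\ holomorphic_on setT psi, harper_eq_on setT E psi &
  exists (Y : R) (up um : C -> C) (fA fB fC fD : C -> C),
    let dp := fun z => - up (1 - z) in
    let dm := fun z => - um (1 - z) in
    [/\ 0 < Y,
        canonical_solution 1 E Y up,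
        canonical_solution (-1) E Y um &
        forall z, upper Y z -> wronskian up um z = lambda%:C] /\
    [/\ forall z, upper Y z -> psi z = fA z * up z + fB z * um z,
        forall z, lower (- Y) z -> psi z = fC z * dp z + fD z * dm z,
        forall f, f = fA \/ f = fB ->
          [/\ holomorphic_on (upper Y) f, periodic_on (upper Y) h f &
              bounded_on (upper Y) f] &
        forall f, f = fC \/ f = fD ->
          [/\ holomorphic_on (lower (- Y)) f, periodic_on (lower (- Y)) h f &
              bounded_on (lower (- Y)) f]] /\
    [/\ lim_down fD 0, lim_down fC 1, lim_up fA AD, lim_up fB BD &
        lim_down (fun z => cexp ((2 * pi / h)%:C * 'i * z) * fD z) DD]].

Definition reflect (psi : C -> C) : C -> C := fun z => psi (1 - z).

Definition solution_vector (psi : C -> C) (x : R) : 'cV[C]_2 :=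
  \col_i (if i == 0 then psi x%:C else reflect psi x%:C).

Definition is_monodromy_matrix (psi : C -> C) (M : R -> 'M[C]_2) : Prop :=
  forall x : R,
    solution_vector psi (x + 1) = M (x / h) *m solution_vector psi x.

Definition coef_a (s t : C) : C :=
  lambda1%:C * (1 - s ^+ 2 - t ^+ 2) / (s * t).

Definition monodromy_form (s t : C) (x : R) : 'M[C]_2 :=
  \matrix_(i, j)
    if i == 0 then
      if j == 0 then coef_a s t - (2 * lambda1 * cos (2 * pi * x))%:C
      else s + t * cexp (- ('i * (2 * pi * x)%:C))
    else
      if j == 0 then - s - t * cexp ('i * (2 * pi * x)%:C)
      else s * t / lambda1%:C.

(* The family E |-> psi_D(., E) of minimal solutions with its asymptotic
   coefficients and its Wronskian W = {psi_D, psi_B}, all meromorphic in E and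
   not identically zero, together with the known form of the monodromy
   matrix. *)
Record minimal_family := MinimalFamily {
  psiD : C -> C -> C;
  AD : C -> C;
  BD : C -> C;
  DD : C -> C;
  W : C -> C;
  sE : C -> C := fun E => - lambda1%:C * DD E / BD E;
  tE : C -> C := fun E => - lambda1%:C * AD E;
  psiD_mero : forall z, meromorphic (fun E => psiD E z);
  AD_mero : meromorphic AD;
  BD_mero : meromorphic BD;
  DD_mero : meromorphic DD;
  W_mero : meromorphic W;
  coefs_neq0 : generically (fun E =>
    [/\ AD E != 0, BD E != 0, DD E != 0 & W E != 0]);
  psiD_minimal : generically (fun E =>
    minimal_solution_D E (psiD E) (AD E) (BD E) (DD E));
  psiD_wronskian : generically (fun E =>
    forall z, wronskian (psiD E) (reflect (psiD E)) z = W E);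
  psiD_monodromy : generically (fun E =>
    is_monodromy_matrix (psiD E) (monodromy_form (sE E) (tE E)))
}.

Definition coef_L (F : minimal_family) (E : C) : C :=
  fourier0 (fun x => \tr (monodromy_form (sE F E) (tE F E) x)).

End Monodromy.

(* Main.v *)
Require Import Defs.
From mathcomp Require Import all_boot all_order all_algebra.
From mathcomp Require Import all_classical all_reals all_analysis.
From mathcomp Require Import complex.
From HB Require Import structures.
From mathcomp Require Import measurable_realfun.
From mathcomp Require Import ring lra zify.

(** The Harper operator H couples x only with x + h and x - h, so on every
    fibre x + h Z it acts as a difference operator
      (A u) n = u (n + 1) + u (n - 1) + (2 lambda cos (2 pi (x + n h)) - E) u n.
    The energy E is in the resolvent set as soon as |A u|^2 >= d |u|^2 for all
    finitely supported u, with d > 0 independent of the fibre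
    ([fibre_bound_resolvent]). Indeed A is symmetric with |A|^2 <= K, so the
    lower bound makes B = 1 - A^2 / K a strict contraction, and
    K^-1 A (1 + B + B^2 + ...) inverts A; integrating the estimates along the
    fibres makes this work on the line.

    The lower bound comes from the monodromy matrix. Write (u n, u (n + 1)) in
    the basis psi_D, psi_B at the point x + n h, reduced modulo 1. The
    coordinates p change by O(|(A u) n|) at each step, and are multiplied by
    the monodromy matrix M each time the fractional part of x + n h wraps
    around. The hypothesis on L and t says that M is hyperbolic in a uniform
    way: there is an indefinite Hermitian form Q, the same for all arguments of
    M, with Q (p M) >= Q p + c |p|^2 ([monodromy_lyapunov]). To find Q, split
    M = m + K + Delta, with m half the trace, K independent of x and Delta
    collecting the oscillating terms off the trace. Both K^2 and the
    anticommutator of K and Delta are scalar, so the form with matrix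
    K + K^* increases, up to the sign of m, by a positive quadratic form
    whenever (L / 2)^2 > 1 + (Im t)^2 + lambda_1 |L|; this follows from the
    hypothesis with C = 8 ([gap_condition]). Adding to Q p the term
    (c / 2) {x + n h} |p|^2, with {y} the fractional part of y, one gets a
    quantity that increases by a multiple of |p|^2 at every step. It vanishes
    at both ends of the support of u, so that the sum of these increases is
    bounded by a multiple of |A u|^2 ([fibre_bound]).

    This argument needs psi_D, its coefficients and the Wronskian to be defined
    and nonzero at E, which may fail on a discrete set. Let E be an exceptional
    energy. All other energies near E satisfy lower bounds, so E could only
    be an isolated point of the spectrum of the fibre operators. Suppose that
    |A u| is very small compared with |u|. Since 0 is isolated for A, iterating
    1 - A^2 / K turns u into an exact square summable solution close to u
    ([exact_solution]). The potential has period 1, and multiples n h with n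
    large come arbitrarily close to integers; so a far translate of u is another
    approximate solution, orthogonal to u, and gives a second exact solution.
    But the Wronskian of two square summable solutions is constant and summable,
    hence zero, and the solutions are proportional, which contradicts the near
    orthogonality ([isolated_fibre]). *)

Set Implicit Arguments.
Unset Strict Implicit.
Unset Printing Implicit Defensive.
Import Order.TTheory GRing.Theory Num.Theory.
Import numFieldNormedType.Exports.
Local Open Scope classical_set_scope.
Local Open Scope ring_scope.
Local Open Scope complex_scope.

(** * Hyperbolicity of the monodromy matrix *)

Section Hyperbolicity.
Variable R : realType.
Local Notation C := R[i].
Local Notation Re := (@complex.Re R).
Local Notation Im := (@complex.Im R).

Definition sqn (z : C) : R := Re z ^+ 2 + Im z ^+ 2.

Lemma sqn_ge0 z : 0 <= sqn z.
Proof. by rewrite addr_ge0 ?sqr_ge0. Qed.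

Lemma sqnM z w : sqn (z * w) = sqn z * sqn w.
Proof. by case: z w => [a b] [c d]; rewrite /sqn /=; ring. Qed.

Lemma sqn_real (x : R) : sqn x%:C = x ^+ 2.
Proof. by rewrite /sqn /=; ring. Qed.

Lemma sqnD z w : sqn (z + w) <= 2 * (sqn z + sqn w).
Proof.
case: z w => [a b] [c d]; rewrite /sqn /=.
by have := sqr_ge0 (a - c); have := sqr_ge0 (b - d); lra.
Qed.

(** The Hermitian form of the matrix [[- a, - i b], [i b, a]] on the row
    vector (x, y). *)
Definition hform (a b : R) (x y : C) : R :=
  a * (sqn y - sqn x) + 2 * b * Im (x * y^*).

Definition hform2 (a b x1 x2 y1 y2 u1 u2 v1 v2 : R) : R :=
  a * (y1 * v1 + y2 * v2 - x1 * u1 - x2 * u2)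
  + b * (x2 * v1 - x1 * v2 + u2 * y1 - u1 * y2).

Lemma hformE a b x1 x2 y1 y2 :
  hform a b (x1 +i* x2) (y1 +i* y2) = hform2 a b x1 x2 y1 y2 x1 x2 y1 y2.
Proof. by rewrite /hform /hform2 /sqn /=; ring. Qed.

(** Writing J for the matrix of the form, J^2 = a^2 + b^2, so that
    Q(p) - Q(p - e) = 2 <p, e J> - <e, e J> is controlled by completing
    squares. *)
Lemma hform_perturb a b kappa : 0 < kappa -> exists2 B, 0 <= B &
  forall x y e f, hform a b (x - e) (y - f) - kappa * (sqn x + sqn y)
     - B * (sqn e + sqn f) <= hform a b x y.
Proof.
move=> k0; exists ((a ^+ 2 + b ^+ 2) / kappa + (1 + a ^+ 2 + b ^+ 2) / 2).
  by rewrite addr_ge0 ?divr_ge0 ?addr_ge0 ?sqr_ge0 // ltW.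
move=> [x1 x2] [y1 y2] [e1 e2] [f1 f2].
rewrite [_ - _]/= [X in hform _ _ _ X]/= !hformE /hform2 /sqn /=.
set j1 := - a * e1 - b * f2; set j2 := - a * e2 + b * f1.
set j3 := a * f1 + b * e2; set j4 := a * f2 - b * e1.
rewrite -subr_ge0; set D := _ - _.
have -> : D = ((kappa * x1 + j1) ^+ 2 + (kappa * x2 + j2) ^+ 2 +
    (kappa * y1 + j3) ^+ 2 + (kappa * y2 + j4) ^+ 2) / kappa +
  ((e1 - j1) ^+ 2 + (e2 - j2) ^+ 2 + (f1 - j3) ^+ 2 + (f2 - j4) ^+ 2) / 2.
  by rewrite /D /j1 /j2 /j3 /j4; field; rewrite gt_eqF.
by rewrite addr_ge0 ?divr_ge0 ?addr_ge0 ?sqr_ge0 // ltW.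
Qed.

(** Row vectors are multiplied on the right by [[m00, m01], [m10, m11]]. If
    this matrix has determinant 1 and real trace 2 m, then T^2 = 2 m T - 1
    turns the increment of Q into two values of the form
    p |-> b (T p - m p, p). *)
Lemma hform_increment a b m x1 x2 y1 y2 u1 u2 v1 v2 z1 z2 w1 w2 :
  z1 = 2 * m * u1 - x1 -> z2 = 2 * m * u2 - x2 ->
  w1 = 2 * m * v1 - y1 -> w2 = 2 * m * v2 - y2 ->
  m * (hform2 a b u1 u2 v1 v2 u1 u2 v1 v2 -
       hform2 a b x1 x2 y1 y2 x1 x2 y1 y2) =
  hform2 a b (u1 - m * x1) (u2 - m * x2) (v1 - m * y1) (v2 - m * y2) x1 x2 y1 y2
  + hform2 a b (z1 - m * u1) (z2 - m * u2) (w1 - m * v1) (w2 - m * v2) u1 u2 v1 v2.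
Proof. by move=> -> -> -> ->; rewrite /hform2; ring. Qed.

(** With d = rho - L / 2 the monodromy matrix is m + K + Delta, where m is half
    its trace, K = [[- d, s], [- s, d]] and K ^+ 2 is scalar; the form is
    J = K + K^*, and K Delta + Delta K = - L l1 c is again scalar. Hence the
    form p |-> p (K + Delta) J p^* is, up to squares, a multiple of |p|^2. Here
    c + i w is the phase factor, and the index 1 or 2 of d, s, t stands for the
    real or the imaginary part. *)
Lemma hform_generator (d1 d2 s1 s2 t1 t2 l1 L c w x1 x2 y1 y2 : R) :
  d1 ^+ 2 - d2 ^+ 2 - s1 ^+ 2 + s2 ^+ 2 - t1 ^+ 2 + t2 ^+ 2 = L ^+ 2 / 4 - 1 ->
  s1 * t1 - s2 * t2 = l1 * (L / 2 + d1) -> c ^+ 2 + w ^+ 2 = 1 ->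
  hform2 (2 * d1) (- 2 * s2)
    (- x1 * (d1 + l1 * c) + x2 * d2 - y1 * (s1 + (t1 * c - t2 * w))
       + y2 * (s2 + (t1 * w + t2 * c)))
    (- x2 * (d1 + l1 * c) - x1 * d2 - y2 * (s1 + (t1 * c - t2 * w))
       - y1 * (s2 + (t1 * w + t2 * c)))
    (x1 * (s1 + (t1 * c + t2 * w)) - x2 * (s2 + (t2 * c - t1 * w))
       + y1 * (d1 + l1 * c) - y2 * d2)
    (x2 * (s1 + (t1 * c + t2 * w)) + x1 * (s2 + (t2 * c - t1 * w))
       + y2 * (d1 + l1 * c) + y1 * d2)
    x1 x2 y1 y2 =
  (- x1 * d1 + x2 * d2 - y1 * s1 + y2 * s2 - t1 * (c * y1 - w * y2)) ^+ 2 +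
  (- x2 * d1 - x1 * d2 - y2 * s1 - y1 * s2 - t1 * (w * y1 + c * y2)) ^+ 2 +
  (x1 * s1 - x2 * s2 + y1 * d1 - y2 * d2 + t1 * (c * x1 + w * x2)) ^+ 2 +
  (x2 * s1 + x1 * s2 + y2 * d1 + y1 * d2 + t1 * (c * x2 - w * x1)) ^+ 2 +
  (L ^+ 2 / 4 - 1 - t2 ^+ 2 - L * l1 * c) *
    (x1 ^+ 2 + x2 ^+ 2 + y1 ^+ 2 + y2 ^+ 2).
Proof.
move=> rA rB rC; rewrite -rA /hform2.
have -> : L * l1 = 2 * (s1 * t1 - s2 * t2) - 2 * l1 * d1 by rewrite rB; field.
apply/eqP; rewrite -subr_eq0; apply/eqP.
transitivity ((x1 ^+ 2 + x2 ^+ 2 + y1 ^+ 2 + y2 ^+ 2) * t1 ^+ 2 *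
   (1 - (c ^+ 2 + w ^+ 2))); last by rewrite rC; ring.
ring.
Qed.

(** The same form works for every phase th, because its matrix K + K^* does not
    see the oscillating part of the monodromy matrix. The sign of L is also that
    of m = L / 2 - l1 cos th, by which the increment has to be divided. *)
Lemma monodromy_lyapunov (s t rho : C) (l1 L : R) :
  0 < l1 -> s * t = l1%:C * rho -> (L%:C - rho) * rho = 1 - s ^+ 2 - t ^+ 2 ->
  2 * l1 < `|L| -> l1 * `|L| < L ^+ 2 / 4 - 1 - Im t ^+ 2 ->
  exists a b, exists2 c, 0 < c & forall th (x y : C),
    let e := cos th +i* sin th in
    hform a b x y + c * (sqn x + sqn y) <=
    hform a b (x * (L%:C - rho - (2 * l1 * cos th)%:C) - y * (s + t * e))
              (x * (s + t * e^* ) + y * rho).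
Proof.
case: s t rho => [s1 s2] [t1 t2] [r1 r2] l0 /[dup] st1 /eqP + /[dup] rr1 /eqP.
rewrite !eq_complex /= => /andP[/eqP stR /eqP stI] /andP[/eqP rrR /eqP rrI].
set d := r1 - L / 2 => Ll k0.
set kap := L ^+ 2 / 4 - 1 - t2 ^+ 2 - l1 * `|L|.
have kap0 : 0 < kap by rewrite subr_gt0.
have rA : d ^+ 2 - r2 ^+ 2 - s1 ^+ 2 + s2 ^+ 2 - t1 ^+ 2 + t2 ^+ 2 = L ^+ 2 / 4 - 1.
  by rewrite /d; move: rrR; rewrite !expr2; nra.
have rB : s1 * t1 - s2 * t2 = l1 * (L / 2 + d) by rewrite stR /d; ring.
have L0 : 0 < `|L| by apply: le_lt_trans Ll; rewrite mulr_ge0 // ltW.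
set sg := Num.sg L.
have sgL : sg * L = `|L| by rewrite -normrEsg.
have sg2 : sg * sg = 1 by rewrite -expr2 sqr_sg -normr_gt0 L0.
exists (sg * (2 * d)), (sg * (- 2 * s2)); exists (kap / (`|L| / 2 + l1)).
  by rewrite divr_gt0 // addr_gt0 // divr_gt0.
move=> th [x1 x2] [y1 y2] /=.
set c := cos th; set w := sin th.
have rC : c ^+ 2 + w ^+ 2 = 1 by rewrite cos2Dsin2.
have c1 : `|c| <= 1 by rewrite cos_max.
rewrite !hformE.
have hsg q1 q2 z1 z2 z3 z4 z5 z6 z7 z8 : hform2 (sg * q1) (sg * q2) z1 z2 z3 z4 z5 z6 z7 z8
   = sg * hform2 q1 q2 z1 z2 z3 z4 z5 z6 z7 z8 by rewrite /hform2; ring.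
rewrite !hsg.
set m := L / 2 - l1 * c.
have gen p1 p2 q1 q2 : kap * (p1 ^+ 2 + p2 ^+ 2 + q1 ^+ 2 + q2 ^+ 2) <=
  hform2 (2 * d) (- 2 * s2)
    (- p1 * (d + l1 * c) + p2 * r2 - q1 * (s1 + (t1 * c - t2 * w))
       + q2 * (s2 + (t1 * w + t2 * c)))
    (- p2 * (d + l1 * c) - p1 * r2 - q2 * (s1 + (t1 * c - t2 * w))
       - q1 * (s2 + (t1 * w + t2 * c)))
    (p1 * (s1 + (t1 * c + t2 * w)) - p2 * (s2 + (t2 * c - t1 * w))
       + q1 * (d + l1 * c) - q2 * r2)
    (p2 * (s1 + (t1 * c + t2 * w)) + p1 * (s2 + (t2 * c - t1 * w))
       + q2 * (d + l1 * c) + q1 * r2)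
    p1 p2 q1 q2.
  rewrite (hform_generator _ _ _ _ rA rB rC) -[leLHS]add0r lerD //.
    by rewrite !addr_ge0 ?sqr_ge0.
  apply: ler_wpM2r; first by rewrite !addr_ge0 ?sqr_ge0.
  rewrite /kap lerD2l lerN2 mulrAC [leLHS]mulrC ler_pM2l //.
  rewrite (le_trans (ler_norm _)) // normrM ler_piMr //.
set u1 := x1 * (L - r1 - 2 * l1 * c) - _ - _.
set u2 := x1 * (0 - r2 - 0) + _ - _.
set v1 := x1 * (s1 + _) - _ + _.
set v2 := x1 * (s2 + _) + _ + _.
(* K + Delta has trace 0, and the determinant of m + K + Delta is 1, so that
   (K + Delta) ^+ 2 = m ^+ 2 - 1; RA and IA are the real and the imaginary part
   of this identity. *)
have RA : (d + l1 * c) ^+ 2 - r2 ^+ 2 - (s1 ^+ 2 - s2 ^+ 2 +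
    2 * c * (s1 * t1 - s2 * t2) + (t1 ^+ 2 - t2 ^+ 2) * (c ^+ 2 + w ^+ 2)) -
    (m ^+ 2 - 1) = 0.
  by rewrite rC rB /m; move: rA => /eqP; rewrite -subr_eq0 => /eqP z; rewrite -[RHS]z; field.
have IA : 2 * (d + l1 * c) * r2 - (2 * s1 * s2 + 2 * c * (s1 * t2 + s2 * t1) +
    2 * t1 * t2 * (c ^+ 2 + w ^+ 2)) = 0.
  by rewrite rC stI mul0r addr0 /d; move: rrI => /eqP; rewrite -subr_eq0 => /eqP z; rewrite -[RHS]oppr0 -z; field.
have e1 : - u1 * (d + l1 * c) + u2 * r2 - v1 * (s1 + (t1 * c - t2 * w))
       + v2 * (s2 + (t1 * w + t2 * c)) = (2 * m * u1 - x1) - m * u1.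
  apply/eqP; rewrite -subr_eq0; apply/eqP.
  transitivity (x1 * 0 - x2 * (0 : R)); last by ring.
  by rewrite -{1}RA -IA /u1 /u2 /v1 /v2 /m /d; field.
have e2 : - u2 * (d + l1 * c) - u1 * r2 - v2 * (s1 + (t1 * c - t2 * w))
       - v1 * (s2 + (t1 * w + t2 * c)) = (2 * m * u2 - x2) - m * u2.
  apply/eqP; rewrite -subr_eq0; apply/eqP.
  transitivity (x2 * 0 + x1 * (0 : R)); last by ring.
  by rewrite -{1}RA -IA /u1 /u2 /v1 /v2 /m /d; field.
have e3 : u1 * (s1 + (t1 * c + t2 * w)) - u2 * (s2 + (t2 * c - t1 * w))
       + v1 * (d + l1 * c) - v2 * r2 = (2 * m * v1 - y1) - m * v1.
  apply/eqP; rewrite -subr_eq0; apply/eqP.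
  transitivity (y1 * 0 - y2 * (0 : R)); last by ring.
  by rewrite -{1}RA -IA /u1 /u2 /v1 /v2 /m /d; field.
have e4 : u2 * (s1 + (t1 * c + t2 * w)) + u1 * (s2 + (t2 * c - t1 * w))
       + v2 * (d + l1 * c) + v1 * r2 = (2 * m * v2 - y2) - m * v2.
  apply/eqP; rewrite -subr_eq0; apply/eqP.
  transitivity (y2 * 0 + y1 * (0 : R)); last by ring.
  by rewrite -{1}RA -IA /u1 /u2 /v1 /v2 /m /d; field.
have := gen u1 u2 v1 v2; rewrite e1 e2 e3 e4.
have := gen x1 x2 y1 y2.
have -> : - x1 * (d + l1 * c) + x2 * r2 - y1 * (s1 + (t1 * c - t2 * w))
       + y2 * (s2 + (t1 * w + t2 * c)) = u1 - m * x1.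
  by rewrite /u1 /m /d; field.
have -> : - x2 * (d + l1 * c) - x1 * r2 - y2 * (s1 + (t1 * c - t2 * w))
       - y1 * (s2 + (t1 * w + t2 * c)) = u2 - m * x2.
  by rewrite /u2 /m /d; field.
have -> : x1 * (s1 + (t1 * c + t2 * w)) - x2 * (s2 + (t2 * c - t1 * w))
       + y1 * (d + l1 * c) - y2 * r2 = v1 - m * y1.
  by rewrite /v1 /m /d; field.
have -> : x2 * (s1 + (t1 * c + t2 * w)) + x1 * (s2 + (t2 * c - t1 * w))
       + y2 * (d + l1 * c) + y1 * r2 = v2 - m * y2.
  by rewrite /v2 /m /d; field.
move=> G1 G2.
have := @hform_increment (2 * d) (- 2 * s2) m x1 x2 y1 y2 u1 u2 v1 v2 _ _ _ _
  erefl erefl erefl erefl.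
set Qu := hform2 _ _ u1 u2 v1 v2 _ _ _ _; set Qx := hform2 _ _ x1 x2 y1 y2 _ _ _ _.
set g1 := (X in _ = X + _ -> _); set g2 := (X in _ = _ + X -> _) => inc.
rewrite /sqn /= addrA.
set N := _ + _ + _ in G1 *.
have N0 : 0 <= N by rewrite /N !addr_ge0 ?sqr_ge0.
have mpos : 0 < sg * m /\ sg * m <= `|L| / 2 + l1.
  have cl : `|sg * (l1 * c)| <= l1.
    by rewrite mulrCA !normrM (gtr0_norm l0) ler_piMr ?(ltW l0) // normr_sg
       -normr_gt0 L0 mul1r.
  rewrite /m mulrBr mulrA sgL; move: cl; rewrite ler_norml => /andP[? ?]; split; lra.
have [m0 mL] := mpos.
rewrite addrC -lerBrDr -mulrBr.
have -> : sg * (Qu - Qx) = (g1 + g2) / (sg * m).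
  by rewrite -inc; apply: (mulIf (lt0r_neq0 m0)); rewrite divfK ?gt_eqF //;
     rewrite mulrCA !mulrA sg2 mul1r mulrC.
have g2_ge0 : 0 <= g2 by apply: le_trans G2; rewrite mulr_ge0 ?(ltW kap0) // !addr_ge0 ?sqr_ge0.
have D0 : 0 < `|L| / 2 + l1 by rewrite addr_gt0 // divr_gt0.
rewrite ler_pdivlMr //.
have -> : kap / (`|L| / 2 + l1) * N * (sg * m) =
    kap * N * (sg * m / (`|L| / 2 + l1)) by ring.
apply: (@le_trans _ _ (kap * N)); last by apply: le_trans G1 _; rewrite lerDl.
rewrite ler_piMr ?mulr_ge0 ?(ltW kap0) //.
by rewrite ler_pdivrMr ?mul1r.
Qed.

End Hyperbolicity.

(** * The Cauchy problem along a fibre *)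

Section FibreBound.
Variable R : realType.
Local Notation C := R[i].

Lemma sqn_sub_perturb (kappa : R) : 0 < kappa -> exists2 B, 0 <= B &
  forall x e : C, sqn (x - e) <= (1 + kappa) * sqn x + B * sqn e.
Proof.
move=> k0; exists (1 + kappa^-1); first by rewrite addr_ge0 // invr_ge0 ltW.
move=> [x1 x2] [e1 e2]; rewrite /sqn /= -subr_ge0.
set D := _ - _.
have -> : D = ((kappa * x1 + e1) ^+ 2 + (kappa * x2 + e2) ^+ 2) / kappa.
  by rewrite /D; field; rewrite gt_eqF.
by rewrite divr_ge0 ?addr_ge0 ?sqr_ge0 // ltW.
Qed.

Definition fracpart (x : R) : R := x - (Num.floor x)%:~R.

Lemma fracpart_itv x : 0 <= fracpart x < 1.
Proof. by rewrite /fracpart subr_ge0 ltrBlDl floor_le -intrD1 floorD1_gt. Qed.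

Lemma fracpartD x h : 0 < h < 1 ->
  fracpart (x + h) = fracpart x + h \/ fracpart (x + h) = fracpart x + h - 1.
Proof.
move=> /andP[h0 h1].
have /andP[f0 f1] := fracpart_itv x.
have [lt1|ge1] := ltP (fracpart x + h) 1.
  left; rewrite /fracpart addrAC.
  have -> : Num.floor (x + h) = Num.floor x; last by [].
  apply/eqP; rewrite -[_ == _]/(_) ; apply/eqP; apply: floor_def.
  move: f0 f1 lt1; rewrite /fracpart intrD1 => *; apply/andP; split; lra.
right; rewrite /fracpart.
have -> : Num.floor (x + h) = Num.floor x + 1; last by rewrite intrD1; ring.
apply: floor_def; rewrite !intrD1.
move: f0 f1 ge1; rewrite /fracpart => *; apply/andP; split; lra.
Qed.

Variables (h : R) (psi1 psi2 : R -> C) (v : R -> R) (W : C).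
Variables (m00 m01 m10 m11 : R -> C).
Hypothesis h01 : 0 < h < 1.
Hypothesis W0 : W != 0.
Hypothesis harper1 : forall x, psi1 (x + h) + psi1 (x - h) + (v x)%:C * psi1 x = 0.
Hypothesis harper2 : forall x, psi2 (x + h) + psi2 (x - h) + (v x)%:C * psi2 x = 0.
Hypothesis wronsk : forall x, psi1 (x + h) * psi2 x - psi1 x * psi2 (x + h) = W.
Hypothesis v_per : forall x (k : int), v (x + k%:~R) = v x.
Hypothesis mono1 : forall x, psi1 (x + 1) = m00 x * psi1 x + m01 x * psi2 x.
Hypothesis mono2 : forall x, psi2 (x + 1) = m10 x * psi1 x + m11 x * psi2 x.
Hypothesis mono_per : forall x, [/\ m00 (x + h) = m00 x, m01 (x + h) = m01 x,
  m10 (x + h) = m10 x & m11 (x + h) = m11 x].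
Hypothesis mono_det : forall x, m00 x * m11 x - m01 x * m10 x = 1.
Variable Bpsi : R.
Hypothesis Bpsi0 : 0 < Bpsi.
Hypothesis psi1_bd : forall x, 0 <= x <= 2 -> sqn (psi1 x) <= Bpsi.
Hypothesis psi2_bd : forall x, 0 <= x <= 2 -> sqn (psi2 x) <= Bpsi.
Variables (a b c : R).
Hypothesis c0 : 0 < c.
Hypothesis lyap : forall x p q, hform a b p q + c * (sqn p + sqn q) <=
  hform a b (p * m00 x + q * m10 x) (p * m01 x + q * m11 x).

(** The coordinates of the solution with values u at r and u' at r + h in the
    basis psi1, psi2, by Cramer's rule. *)
Definition coord1 (r : R) (u u' : C) := (u' * psi2 r - u * psi2 (r + h)) / W.
Definition coord2 (r : R) (u u' : C) := (u * psi1 (r + h) - u' * psi1 r) / W.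

Lemma coordK r u u' : coord1 r u u' * psi1 r + coord2 r u u' * psi2 r = u.
Proof.
have -> : coord1 r u u' * psi1 r + coord2 r u u' * psi2 r =
  u * (psi1 (r + h) * psi2 r - psi1 r * psi2 (r + h)) / W.
  by rewrite /coord1 /coord2; ring.
by rewrite wronsk mulfK.
Qed.

Lemma coord_mono1 r u u' : coord1 r u u' =
  coord1 (r + 1) u u' * m00 r + coord2 (r + 1) u u' * m10 r.
Proof.
have [e1 e2 e3 e4] := mono_per r.
rewrite /coord1 /coord2 -!(addrAC r h) !mono1 !mono2 e1 e2 e3 e4.
transitivity ((u' * psi2 r - u * psi2 (r + h)) *
  (m00 r * m11 r - m01 r * m10 r) / W); first by rewrite mono_det mulr1.
by ring.
Qed.

Lemma coord_mono2 r u u' : coord2 r u u' =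
  coord1 (r + 1) u u' * m01 r + coord2 (r + 1) u u' * m11 r.
Proof.
have [e1 e2 e3 e4] := mono_per r.
rewrite /coord1 /coord2 -!(addrAC r h) !mono1 !mono2 e1 e2 e3 e4.
transitivity ((u * psi1 (r + h) - u' * psi1 r) *
  (m00 r * m11 r - m01 r * m10 r) / W); first by rewrite mono_det mulr1.
by ring.
Qed.

Lemma coord_step1 r (u u' u'' : R) :
  coord1 r u%:C u'%:C = coord1 (r + h) u'%:C u''%:C -
    (u'' + u + v (r + h) * u')%:C * psi2 (r + h) / W.
Proof.
have := harper2 (r + h); rewrite addrK -addrA => /eqP.
rewrite addr_eq0 => /eqP E; rewrite /coord1 E !rmorphD rmorphM /=.
by ring.
Qed.

Lemma coord_step2 r (u u' u'' : R) :
  coord2 r u%:C u'%:C = coord2 (r + h) u'%:C u''%:C -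
    - (u'' + u + v (r + h) * u')%:C * psi1 (r + h) / W.
Proof.
have := harper1 (r + h); rewrite addrK -addrA => /eqP.
rewrite addr_eq0 => /eqP E; rewrite /coord2 E !rmorphD rmorphM /=.
by ring.
Qed.

(** Without wrap-around the fractional part grows by h; with it, the weight
    (c / 2) {x} loses at most c / 2 while the form gains c. *)
Lemma hform_step x0 i (u u' : C) (x0' := x0 + i%:R * h) (x0'' := x0 + i.+1%:R * h)
    (x := coord1 (fracpart x0' + h) u u') (y := coord2 (fracpart x0' + h) u u')
    (x' := coord1 (fracpart x0'') u u') (y' := coord2 (fracpart x0'') u u') :
  hform a b x y + (c / 2 * fracpart x0' + c * h / 2) * (sqn x + sqn y) <=
  hform a b x' y' + (c / 2 * fracpart x0'') * (sqn x' + sqn y').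
Proof.
have /andP[h0 h1] := h01.
have x0E : x0'' = x0' + h by rewrite /x0'' /x0' -natr1; ring.
have N0 : 0 <= sqn x + sqn y by rewrite addr_ge0 ?sqn_ge0.
have N1 : 0 <= sqn x' + sqn y' by rewrite addr_ge0 ?sqn_ge0.
have [f|f] := fracpartD x0' h01; rewrite -x0E in f.
  rewrite -[leRHS]/(hform a b x' y' + _ * (sqn x' + sqn y')).
  rewrite /x' /y' f -/x -/y lerD2l.
  by apply: ler_wpM2r => //; lra.
have f1 : fracpart x0' + h = fracpart x0'' + 1 by rewrite f subrK.
have L := lyap (fracpart x0'') x y.
have e1 : x * m00 (fracpart x0'') + y * m10 (fracpart x0'') = x'.
  by rewrite /x /y /x' f1 -coord_mono1.
have e2 : x * m01 (fracpart x0'') + y * m11 (fracpart x0'') = y'.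
  by rewrite /x /y /y' f1 -coord_mono2.
rewrite e1 e2 in L.
have /andP[f0 _] := fracpart_itv x0''.
have A : 0 <= c / 2 * fracpart x0'' * (sqn x' + sqn y').
  by rewrite !mulr_ge0 ?divr_ge0 // ltW.
have B : (c / 2 * fracpart x0' + c * h / 2) * (sqn x + sqn y) <= c * (sqn x + sqn y).
  apply: ler_wpM2r => //; have /andP[? ?] := fracpart_itv x0'.
  have : 0 <= c * (2 - fracpart x0' - h) by apply: mulr_ge0; [exact: ltW | lra].
  lra.
lra.
Qed.

(** Along a sequence that vanishes at both ends the quantity of the previous lemma
    returns to 0, so its gains are paid for by the right-hand sides. *)
Lemma fibre_bound : exists2 K, 0 < K & forall x0 (U : nat -> R) m,
  U 0%N = 0 -> U 1%N = 0 -> U m = 0 -> U m.+1 = 0 ->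
  \sum_(i < m) U i.+1 ^+ 2 <=
  K * \sum_(i < m) (U i.+2 + U i + v (x0 + i.+1%:R * h) * U i.+1) ^+ 2.
Proof.
have /andP[h0 h1] := h01.
have ch0 : 0 < c * h by rewrite mulr_gt0.
(* The losses c h / 8 and (c / 2) (h / 4) leave half of the gain c h / 2. *)
have [B1 B1_ge0 perturb] := @hform_perturb R a b (c * h / 8) ltac:(by rewrite divr_gt0).
have [B2 B2_ge0 sub_perturb] := @sqn_sub_perturb (h / 4) ltac:(by rewrite divr_gt0).
have nW : 0 < sqn W^-1.
  rewrite lt_def sqn_ge0 andbT; apply/eqP => z.
  have : sqn (W * W^-1) = 0 by rewrite sqnM z mulr0.
  by rewrite divff // sqn_real expr1n => /eqP; rewrite oner_eq0.
set D := (B1 + c / 2 * B2) * (2 * Bpsi * sqn W^-1).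
have cB : 0 <= B1 + c / 2 * B2.
  by rewrite addr_ge0 // mulr_ge0 // divr_ge0 // ltW.
have D0 : 0 <= D.
  by rewrite mulr_ge0 // mulr_ge0 ?(ltW nW) // mulr_ge0 // ltW.
exists ((8 * Bpsi / (c * h)) * (D + 1)).
  by rewrite !mulr_gt0 ?invr_gt0 // ltr_wpDl.
move=> x0 U m U0 U1 Um Um1.
set g := fun i : nat => U i.+2 + U i + v (x0 + i.+1%:R * h) * U i.+1.
set r := fun i : nat => fracpart (x0 + i%:R * h).
set x := fun i => coord1 (r i) (U i)%:C (U i.+1)%:C.
set y := fun i => coord2 (r i) (U i)%:C (U i.+1)%:C.
set V := fun i : nat => hform a b (x i) (y i) + c / 2 * r i * (sqn (x i) + sqn (y i)).
have step i : c * h / (8 * Bpsi) * U i.+1 ^+ 2 <= V i.+1 - V i + D * g i ^+ 2.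
  set p := coord1 (r i + h) (U i.+1)%:C (U i.+2)%:C.
  set q := coord2 (r i + h) (U i.+1)%:C (U i.+2)%:C.
  have gE : U i.+2 + U i + v (r i + h) * U i.+1 = g i.
    rewrite /g -(v_per (r i + h) (Num.floor (x0 + i%:R * h))).
    by congr (_ + _ + v _ * _); rewrite /r /fracpart -natr1; ring.
  have xE : x i = p - (g i)%:C * psi2 (r i + h) / W.
    by rewrite /x (coord_step1 _ _ _ (U i.+2)) gE.
  have yE : y i = q - - (g i)%:C * psi1 (r i + h) / W.
    by rewrite /y (coord_step2 _ _ _ (U i.+2)) gE.
  have S : hform a b p q + (c / 2 * r i + c * h / 2) * (sqn p + sqn q) <= V i.+1.
    exact: hform_step.
  have /andP[r0 r1] := fracpart_itv (x0 + i%:R * h); rewrite -/(r i) in r0 r1.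
  have rh : 0 <= r i + h <= 2 by apply/andP; split; lra.
  set e := (g i)%:C * psi2 (r i + h) / W in xE.
  set f := - (g i)%:C * psi1 (r i + h) / W in yE.
  have eb : sqn e + sqn f <= 2 * Bpsi * sqn W^-1 * g i ^+ 2.
    rewrite /e /f !sqnM -rmorphN !sqn_real sqrrN.
    have := psi1_bd rh; have := psi2_bd rh; have := sqr_ge0 (g i).
    set s1 := sqn (psi1 _); set s2 := sqn (psi2 _); set G := _ ^+ 2 => G0 b2 b1.
    have -> : G * s2 * sqn W^-1 + G * s1 * sqn W^-1 = G * sqn W^-1 * (s1 + s2) by ring.
    have -> : 2 * Bpsi * sqn W^-1 * G = G * sqn W^-1 * (Bpsi + Bpsi) by ring.
    by apply: ler_wpM2l; [rewrite mulr_ge0 // ltW | exact: lerD].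
  have N0 : 0 <= sqn p + sqn q by rewrite addr_ge0 ?sqn_ge0.
  have ub : U i.+1 ^+ 2 <= 2 * Bpsi * (sqn p + sqn q).
    rewrite -sqn_real -[(U _)%:C](coordK (r i + h) _ (U i.+2)%:C) -/p -/q.
    apply: le_trans (sqnD _ _) _; rewrite -mulrA ler_pM2l //.
    rewrite (sqnM p) (sqnM q) [leRHS]mulrDr ![Bpsi * _]mulrC.
    by apply: lerD; apply: ler_wpM2l; rewrite ?sqn_ge0 ?psi1_bd ?psi2_bd.
  have h1' := perturb p q e f; rewrite -xE -yE in h1'.
  have h2 := sub_perturb p e; rewrite -xE in h2.
  have h3 := sub_perturb q f; rewrite -yE in h3.
  have h4 : c / 2 * r i * (sqn (x i) + sqn (y i)) <=
     c / 2 * r i * (sqn p + sqn q) + c * h / 8 * (sqn p + sqn q)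
       + c / 2 * B2 * (sqn e + sqn f).
    set s := sqn (x i) + sqn (y i); set pq := sqn p + sqn q.
    set ef := sqn e + sqn f.
    have hs : s - pq <= h / 4 * pq + B2 * ef by rewrite /s /pq /ef; lra.
    have : c / 2 * r i * (s - pq) <= c / 2 * 1 * (h / 4 * pq + B2 * ef).
      have X : 0 <= h / 4 * pq + B2 * ef.
        apply: addr_ge0; apply: mulr_ge0 => //; last by rewrite addr_ge0 ?sqn_ge0.
        by rewrite divr_ge0 // ltW.
      apply: (@le_trans _ _ (c / 2 * r i * (h / 4 * pq + B2 * ef))).
        by apply: ler_wpM2l => //; apply: mulr_ge0 => //; rewrite divr_ge0 // ltW.
      apply: ler_wpM2r => //; apply: ler_wpM2l; last exact: ltW.
      by rewrite divr_ge0 // ltW.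
    rewrite mulr1; lra.
  have h5 : (B1 + c / 2 * B2) * (sqn e + sqn f) <= D * g i ^+ 2.
    by rewrite /D -[leRHS]mulrA ler_wpM2l.
  have h6 : c * h / (8 * Bpsi) * U i.+1 ^+ 2 <= c * h / 4 * (sqn p + sqn q).
    have -> : c * h / 4 * (sqn p + sqn q) = c * h / (8 * Bpsi) * (2 * Bpsi * (sqn p + sqn q)).
      by field; rewrite gt_eqF.
    by apply: ler_wpM2l => //; rewrite divr_ge0 ?mulr_ge0 // ltW.
  rewrite /V; rewrite /V in S; lra.
have V0 j : U j = 0 -> U j.+1 = 0 -> V j = 0.
  move=> e1 e2.
  have z1 : x j = 0 by rewrite /x /coord1 e1 e2 rmorph0 !mul0r subr0 mul0r.
  have z2 : y j = 0 by rewrite /y /coord2 e1 e2 rmorph0 !mul0r subr0 mul0r.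
  by rewrite /V z1 z2 /hform mul0r /sqn /= !expr0n /=; ring.
have tot : c * h / (8 * Bpsi) * \sum_(i < m) U i.+1 ^+ 2 <= D * \sum_(i < m) g i ^+ 2.
  rewrite !mulr_sumr.
  have -> : \sum_(i < m) D * g i ^+ 2 = \sum_(i < m) (V i.+1 - V i + D * g i ^+ 2).
    rewrite big_split /= -(big_mkord xpredT (fun i => V i.+1 - V i)).
    by rewrite telescope_sumr // !V0 // subrr add0r.
  by apply: ler_sum => i _; exact: step.
set S := \sum_(i < m) _ in tot *; set G := \sum_(i < m) _ in tot *.
have G0 : 0 <= G by apply: sumr_ge0 => i _; exact: sqr_ge0.
rewrite -invf_div in tot.
have K0 : 0 < 8 * Bpsi / (c * h) by rewrite divr_gt0 // mulr_gt0.
rewrite -[leRHS]mulrA -ler_pdivrMl //; apply: le_trans tot _.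
by apply: ler_wpM2r => //; rewrite lerDl.
Qed.

End FibreBound.

(** * Symmetric operators with an isolated point of the spectrum *)

Section SymmetricOperators.
Variables (R : realType) (V : lmodType R) (ip : V -> V -> R).
Hypothesis ipC : forall u v, ip u v = ip v u.
Hypothesis ipDl : forall u v w, ip (u + v) w = ip u w + ip v w.
Hypothesis ipZl : forall a u v, ip (a *: u) v = a * ip u v.
Hypothesis ip_ge0 : forall u, 0 <= ip u u.

Let ipDr u v w : ip w (u + v) = ip w u + ip w v.
Proof. by rewrite ![ip w _]ipC ipDl. Qed.
Let ipZr a u v : ip v (a *: u) = a * ip v u.
Proof. by rewrite ![ip v _]ipC ipZl. Qed.
Let ipNl u v : ip (- u) v = - ip u v.
Proof. by rewrite -scaleN1r ipZl mulN1r. Qed.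
Let ipNr u v : ip v (- u) = - ip v u.
Proof. by rewrite -scaleN1r ipZr mulN1r. Qed.
Definition ipE := (ipDl, ipDr, ipNl, ipNr, ipZl, ipZr).

Lemma form_cauchy_schwarz (b : V -> V -> R) :
  (forall u v, b u v = b v u) ->
  (forall u v w, b (u + v) w = b u w + b v w) ->
  (forall a u v, b (a *: u) v = a * b u v) -> (forall u, 0 <= b u u) ->
  forall u v, b u v ^+ 2 <= b u u * b v v.
Proof.
move=> bC bD bZ b0 u v.
have bDr x y z : b z (x + y) = b z x + b z y by rewrite ![b z _]bC bD.
have bZr c x z : b z (c *: x) = c * b z x by rewrite ![b z _]bC bZ.
have q c : 0 <= b u u + 2 * c * b u v + c ^+ 2 * b v v.
  have := b0 (u + c *: v); rewrite bD !bDr bZ !bZr bZ [b v u]bC.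
  by congr (0 <= _); ring.
have [v0|v0] := eqVneq (b v v) 0.
  rewrite v0 mulr0; have [->|uv] := eqVneq (b u v) 0; first by rewrite expr0n.
  have := q (- (b u u + 1) / (2 * b u v)).
  rewrite v0 mulr0 addr0.
  have -> : 2 * (- (b u u + 1) / (2 * b u v)) * b u v = - (b u u + 1).
    by field.
  by rewrite opprD addrA subrr add0r oppr_ge0 ler10.
have vp : 0 < b v v by rewrite lt_def v0 b0.
have := q (- b u v / b v v).
have -> : b u u + 2 * (- b u v / b v v) * b u v + (- b u v / b v v) ^+ 2 * b v v
   = (b u u * b v v - b u v ^+ 2) / b v v by field.
by rewrite pmulr_lge0 ?invr_gt0 // subr_ge0.
Qed.

Record bounded_symmetric (K : R) (T : V -> V) := BoundedSymmetric {
  bsD : forall u v, T (u + v) = T u + T v;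
  bsZ : forall a u, T (a *: u) = a *: T u;
  bs_sym : forall u v, ip (T u) v = ip u (T v);
  bs_bd : forall u, ip (T u) (T u) <= K * ip u u
}.

Lemma bsB K T : bounded_symmetric K T -> forall u v, T (u - v) = T u - T v.
Proof. by move=> bT u v; rewrite -scaleN1r (bsD bT) (bsZ bT) scaleN1r. Qed.

(** For 0 <= A ^+ 2 <= K this damps the part of u where A is large and keeps the
    kernel of A: its powers converge to the projection onto the kernel. *)
Definition damp (K : R) (A : V -> V) u := u - K^-1 *: A (A u).

Lemma damp_le K A u : 0 < K -> bounded_symmetric K A ->
  ip (damp K A u) (damp K A u) <= ip u u - ip (A u) (A u) / K.
Proof.
move=> K0 bA; have b1 := bs_bd bA (A u).
rewrite /damp !ipE -(bs_sym bA u) (bs_sym bA _ u).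
set n := ip (A u) (A u); set m := ip _ _ in b1 *.
have : K^-1 * (K^-1 * m) <= K^-1 * n.
  by rewrite ler_pM2l ?invr_gt0 // ler_pdivrMl.
lra.
Qed.

(** The largest y <= a ^+ 2 with y |u|^2 <= |T u|^2 cannot be smaller than
    a ^+ 2: otherwise X = T ^+ 2 - y is nonnegative and factors as
    (T - e) (T + e) with |e| < a, so that |X u|^2 is bounded below; since X is
    nonnegative, |X u|^2 <= K <X u, u>, and y could be increased. *)
Lemma spectral_gap K T a : 0 < K -> 0 < a -> bounded_symmetric K T ->
  (forall e, `|e| < a -> exists2 d, 0 < d &
     forall u, d * ip u u <= ip (T u - e *: u) (T u - e *: u)) ->
  forall u, a ^+ 2 * ip u u <= ip (T u) (T u).
Proof.
move=> K0 a0 bT bdd.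
set E : set R := [set y | 0 <= y <= a ^+ 2 /\
  forall u, y * ip u u <= ip (T u) (T u)].
have E0 : E 0 by split=> [|u]; rewrite ?lexx ?sqr_ge0 // mul0r ip_ge0.
have supE : has_sup E by split; [exists 0 | exists (a ^+ 2) => y [/andP[]]].
set Y := sup E.
have Y0 : 0 <= Y by apply: ub_le_sup (E0); case: supE.
have Ya : Y <= a ^+ 2 by apply: ge_sup; [exists 0 | move=> y [/andP[]]].
have YE u : Y * ip u u <= ip (T u) (T u).
  have [->|u0] := eqVneq (ip u u) 0; first by rewrite mulr0 ip_ge0.
  have up : 0 < ip u u by rewrite lt_def u0 ip_ge0.
  rewrite -ler_pdivlMr //; apply: ge_sup; first by exists 0.
  by move=> y [_ /(_ u)]; rewrite -ler_pdivlMr.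
have [Ylt|] := ltP Y (a ^+ 2); last first.
  by move=> aY u; apply: le_trans (YE u); apply: ler_wpM2r.
set e := Num.sqrt Y.
have e2 : e ^+ 2 = Y by rewrite sqr_sqrtr.
have ea : `|e| < a.
  by rewrite ger0_norm ?sqrtr_ge0 // -(ltr_pXn2r (n:=2)) ?nnegrE ?sqrtr_ge0 ?(ltW a0) // e2.
have [d1 d1p D1] := bdd e ea.
have [d2 d2p D2] := bdd (- e) ltac:(by rewrite normrN).
set X := fun u => T (T u) - Y *: u.
set b := fun u v => ip (T u) (T v) - Y * ip u v.
have b_cs : forall u v, b u v ^+ 2 <= b u u * b v v.
  apply: form_cauchy_schwarz; rewrite /b.
  - by move=> u v; rewrite ipC [ip u v]ipC.
  - by move=> u v w; rewrite (bsD bT) !ipE; ring.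
  - by move=> c u v; rewrite (bsZ bT) !ipE; ring.
  - by move=> u; rewrite subr_ge0.
have bX u v : b u v = ip (X u) v by rewrite /b /X !ipE -(bs_sym bT).
have Xlow u : d1 * d2 * ip u u <= ip (X u) (X u).
  have -> : X u = T (T u - (- e) *: u) - e *: (T u - (- e) *: u).
    rewrite (bsB bT) (bsZ bT) scalerBr scalerA mulrN -expr2 e2 /X.
    by rewrite !scaleNr !opprK opprD addrA addrK.
  apply: le_trans (D1 _); rewrite -mulrA ler_pM2l //; exact: D2.
have Xup u : ip (X u) (X u) <= K * b u u.
  have := b_cs u (X u); rewrite {1}bX [ip (X u) (X u)]lock.
  have : b (X u) (X u) <= K * ip (X u) (X u).
    apply: le_trans (bs_bd bT _); rewrite lerBlDr lerDl.
    by rewrite mulr_ge0 // ip_ge0.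
  rewrite -lock; set n := ip (X u) (X u); set q := b (X u) _ => qn nq.
  have b0 : 0 <= b u u by rewrite /b subr_ge0 YE.
  have n0 : 0 <= n by exact: ip_ge0.
  have [->|n_neq0] := eqVneq n 0; first by rewrite mulr_ge0 // ltW.
  have np : 0 < n by rewrite lt_def n_neq0.
  rewrite -(ler_pM2r np) -expr2; apply: le_trans nq _.
  by rewrite [K * _]mulrC -mulrA ler_wpM2l.
set z := Num.min (a ^+ 2) (Y + d1 * d2 / K).
have zE : E z.
  split=> [|u].
    rewrite /z ge_min lexx /= le_min sqr_ge0 /=.
    by rewrite addr_ge0 // divr_ge0 ?mulr_ge0 // ltW.
  apply: (@le_trans _ _ ((Y + d1 * d2 / K) * ip u u)).
    by apply: ler_wpM2r; rewrite ?ip_ge0 // ge_min lexx orbT.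
  rewrite mulrDl -lerBrDl -/(b u u) mulrAC ler_pdivrMr // mulrC.
  by rewrite [b u u * _]mulrC mulrC; apply: le_trans (Xup u).
have : z <= Y by apply: ub_le_sup zE; case: supE.
rewrite leNgt /z lt_min Ylt /= ltrDl divr_gt0 ?mulr_gt0 //.
Qed.

Section Isolated.
Variables (K : R) (A : V -> V) (eps : R).
Hypotheses (K0 : 0 < K) (bA : bounded_symmetric K A) (eps0 : 0 < eps).
Hypothesis gap : forall e, 0 < `|e| < eps -> exists2 d, 0 < d &
  forall u, d * ip u u <= ip (A u - e *: u) (A u - e *: u).

(** The interval between 0 and sg eps has no spectrum; completing the square in
    (A - sg eps / 2) ^+ 2 >= (eps / 2) ^+ 2 gives the claim. *)
Lemma gap_form sg u : `|sg| = 1 -> sg * eps * ip (A u) u <= ip (A u) (A u).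
Proof.
move=> sg1.
have sg2 : sg ^+ 2 = 1 by rewrite -real_normK ?num_real // sg1 expr1n.
set T := fun u => A u - (sg * eps / 2) *: u.
have bT : bounded_symmetric (2 * (K + eps ^+ 2)) T.
  split; rewrite /T.
  - by move=> x y; rewrite (bsD bA) scalerDr opprD addrACA.
  - by move=> c x; rewrite (bsZ bA) scalerBr !scalerA [c * _]mulrC.
  - by move=> x y; rewrite !ipE (bs_sym bA).
  - move=> x; have := ip_ge0 (A x + (sg * eps / 2) *: x); rewrite !ipE.
    have := bs_bd bA x; rewrite [ip x (A x)]ipC.
    have -> : sg * eps / 2 * (sg * eps / 2 * ip x x) = sg ^+ 2 * eps ^+ 2 / 4 * ip x x by field.
    rewrite sg2 mul1r.
    have : 0 <= eps ^+ 2 * ip x x by rewrite mulr_ge0 ?sqr_ge0.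
    lra.
have e2 : 0 < eps / 2 by rewrite divr_gt0.
have K2 : 0 < 2 * (K + eps ^+ 2) by rewrite mulr_gt0 // addr_gt0 // exprn_gt0.
have := spectral_gap K2 e2 bT.
move=> /(_ _ u) => H.
have {}H : (eps / 2) ^+ 2 * ip u u <= ip (T u) (T u).
  apply: H => e ee.
  have [|d d0 dP] := gap (e := sg * eps / 2 + e).
    have n2 : `|sg * eps / 2| = eps / 2.
      by rewrite !normrM sg1 mul1r !gtr0_norm // invr_gt0.
    apply/andP; split.
      rewrite normr_gt0; apply: contraTneq ee => /eqP.
      by rewrite addrC addr_eq0 => /eqP ->; rewrite normrN n2 ltxx.
    by apply: le_lt_trans (ler_normD _ _) _; rewrite n2; lra.
  exists d => // x; have := dP x; rewrite scalerDl opprD addrA; exact.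
move: H; rewrite /T !ipE [ip u (A u)]ipC.
have -> : sg * eps / 2 * (sg * eps / 2 * ip u u) = sg ^+ 2 * eps ^+ 2 / 4 * ip u u by field.
rewrite sg2 mul1r; lra.
Qed.

(** X = A ^+ 2 - eps A and Y = A ^+ 2 + eps A are nonnegative and commute;
    X Y (X + Y) / 2 >= 0 is the claim. *)
Lemma gap_pow u :
  eps ^+ 2 * ip (A (A u)) (A (A u)) <= ip (A (A (A u))) (A (A (A u))).
Proof.
have h1 := gap_form (A (A u) - eps *: A u) (normrN1 R).
have h2 := gap_form (A (A u) + eps *: A u) (normr1 R).
move: h1 h2; rewrite (bsB bA) (bsD bA) !(bsZ bA) !ipE.
set a1 := A u; set a2 := A a1; set a3 := A a2.
have e31 : ip a3 a1 = ip a2 a2 by rewrite (bs_sym bA).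
rewrite [ip a2 a3]ipC e31; lra.
Qed.

(** On the range of A ^+ 2 the operator 1 - A ^+ 2 / K is a contraction. *)
Lemma damp_ran u : ip (damp K A (A (A u))) (damp K A (A (A u))) <=
  (1 - eps ^+ 2 / K) * ip (A (A u)) (A (A u)).
Proof.
have h := damp_le (A (A u)) K0 bA; apply: le_trans h _; rewrite mulrBl mul1r lerD2l lerN2.
by rewrite mulrAC ler_pM2r ?invr_gt0 //; exact: gap_pow.
Qed.

Definition ipn u := Num.sqrt (ip u u).

Lemma ipn_ge0 u : 0 <= ipn u.
Proof. exact: sqrtr_ge0. Qed.

Lemma ipn_sqr u : ipn u ^+ 2 = ip u u.
Proof. by rewrite sqr_sqrtr. Qed.

Lemma ip_ipn u v : ip u v <= ipn u * ipn v.
Proof.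
apply: le_trans (ler_norm _) _.
rewrite -(ler_pXn2r (n:=2)) ?nnegrE ?mulr_ge0 ?ipn_ge0 //.
rewrite exprMn !ipn_sqr real_normK ?num_real //.
exact: form_cauchy_schwarz.
Qed.

Lemma ipnD u v : ipn (u + v) <= ipn u + ipn v.
Proof.
rewrite -(ler_pXn2r (n:=2)) ?nnegrE ?addr_ge0 ?sqrtr_ge0 //.
rewrite sqrrD !ipn_sqr !ipE [ip v u]ipC; have := ip_ipn u v; lra.
Qed.

Lemma ipnZ a u : ipn (a *: u) = `|a| * ipn u.
Proof. by rewrite /ipn !ipE mulrA -expr2 sqrtrM ?sqr_ge0 // sqrtr_sqr. Qed.

Let q := Num.sqrt (1 - eps ^+ 2 / K).

Let q_ge0 : 0 <= q. Proof. exact: sqrtr_ge0. Qed.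

Let q_lt1 : q < 1.
Proof.
rewrite /q -{2}[1]sqrtr1 ltr_sqrt // ltrBlDr ltrDl.
by rewrite divr_gt0 // exprn_gt0.
Qed.

Let dampA u : A (A (damp K A u)) = damp K A (A (A u)).
Proof. by rewrite /damp !(bsB bA) !(bsZ bA). Qed.

(** Since A ^+ 2 commutes with 1 - A ^+ 2 / K, the increments of the damped
    sequence decrease geometrically. *)
Lemma iter_damp_decay n v :
  ipn (A (A (iter n (damp K A) v))) <= q ^+ n * ipn (A (A v)).
Proof.
elim: n => [|n IH]; first by rewrite expr0 mul1r.
rewrite iterS dampA exprS -mulrA; set u := iter n _ v in IH *.
apply: (@le_trans _ _ (q * ipn (A (A u)))); last by apply: ler_wpM2l.
have h := damp_ran u; rewrite -(ler_pXn2r (n:=2)) ?nnegrE ?mulr_ge0 ?ipn_ge0 //.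
rewrite exprMn !ipn_sqr; apply: le_trans h _; apply: ler_wpM2r => //.
by have [c0|c0] := leP 0 (1 - eps ^+ 2 / K);
  [rewrite sqr_sqrtr | apply: le_trans (ltW c0) (sqr_ge0 _)].
Qed.

Lemma iter_damp_incr n v :
  ipn (iter n.+1 (damp K A) v - iter n (damp K A) v) <=
  K^-1 * ipn (A (A v)) * q ^+ n.
Proof.
rewrite iterS {1}/damp addrAC subrr add0r -scaleNr ipnZ normrN gtr0_norm ?invr_gt0 //.
by rewrite -mulrA [_ * q ^+ n]mulrC ler_pM2l ?invr_gt0 //; exact: iter_damp_decay.
Qed.

Lemma iter_damp_close n v :
  ipn (iter n (damp K A) v - v) <= K^-1 * ipn (A (A v)) / (1 - q).
Proof.
have c0 : 0 <= K^-1 * ipn (A (A v)) by rewrite mulr_ge0 ?ipn_ge0 // invr_ge0 ltW.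
have q1 : 0 < 1 - q by rewrite subr_gt0.
suff : ipn (iter n (damp K A) v - v) <= K^-1 * ipn (A (A v)) * (1 - q ^+ n) / (1 - q).
  move=> h; apply: le_trans h _; rewrite ler_pM2r ?invr_gt0 // ler_piMr //.
  by rewrite lerBlDr lerDl exprn_ge0.
elim: n => [|n IH].
  by rewrite subrr /ipn -(scale0r v) ipZl mul0r sqrtr0 expr0 subrr mulr0 mul0r.
rewrite -(subrK (iter n (damp K A) v) (iter n.+1 _ _)) -addrA.
apply: le_trans (ipnD _ _) _.
apply: le_trans (lerD (iter_damp_incr n v) IH) _.
rewrite exprS; set c := K^-1 * _; rewrite le_eqVlt; apply/orP; left; apply/eqP.
by field; rewrite gt_eqF.
Qed.

Lemma iter_damp_le n v : ip (iter n (damp K A) v) (iter n (damp K A) v) <= ip v v.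
Proof.
elim: n => [//|n IH]; rewrite iterS; apply: le_trans IH.
have h := damp_le (iter n (damp K A) v) K0 bA; apply: le_trans h _.
by rewrite lerBlDr lerDl divr_ge0 // ltW.
Qed.

Lemma iter_damp_ker n v :
  ip (A (iter n (damp K A) v)) (A (iter n (damp K A) v)) <=
  ipn (A (A v)) * ipn v * q ^+ n.
Proof.
rewrite -(bs_sym bA); apply: le_trans (ip_ipn _ _) _.
rewrite mulrAC; apply: ler_pM; rewrite ?ipn_ge0 //.
  by rewrite mulrC; exact: iter_damp_decay.
by rewrite ler_sqrt //; exact: iter_damp_le.
Qed.

End Isolated.
End SymmetricOperators.

(** * Finitely supported sequences *)

Section FiniteSequences.
Variable R : realType.

Definition supported (N : nat) (u : int -> R) := forall n : int, (N < `|n|)%N -> u n = 0.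

Definition fs_pred : {pred (int -> R)} := fun u => `[< exists N, supported N u >].

Lemma fs_predP u : reflect (exists N, supported N u) (u \in fs_pred).
Proof. exact: asboolP. Qed.

Lemma supported_le N M u : (N <= M)%N -> supported N u -> supported M u.
Proof. by move=> NM uN n Mn; apply: uN; apply: leq_ltn_trans Mn. Qed.

Lemma fs_submod : submod_closed fs_pred.
Proof.
split=> [|a u v]; first by apply/fs_predP; exists 0%N.
move=> /fs_predP[N uN] /fs_predP[M vM]; apply/fs_predP; exists (maxn N M) => n Nn.
rewrite !fctE.
by rewrite (supported_le (leq_maxl N M) uN) ?(supported_le (leq_maxr N M) vM) // scaler0 addr0.
Qed.

HB.instance Definition _ := GRing.isSubmodClosed.Build R (int -> R) fs_pred fs_submod.

End FiniteSequences.

Record fseq (R : realType) := FSeq { fsval :> int -> R; _ : fsval \in @fs_pred R }.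
HB.instance Definition _ (R : realType) := [isSub for @fsval R].
HB.instance Definition _ (R : realType) := [Choice of fseq R by <:].
HB.instance Definition _ (R : realType) := [SubChoice_isSubLmodule of fseq R by <:].

Section FiniteSequenceTheory.
Variable R : realType.
Implicit Types (u v : fseq R) (N : nat).

Lemma fseqP u : exists N, supported N u.
Proof. by case: u => u /= /fs_predP. Qed.

Lemma fseqD u v n : (u + v : fseq R) n = u n + v n.
Proof.
suff -> : fsval (u + v) = fsval u + fsval v by [].
exact: (raddfD (val : fseq R -> (int -> R))).
Qed.

Lemma fseqN u n : (- u : fseq R) n = - u n.
Proof.
suff -> : fsval (- u) = - fsval u by [].
exact: (raddfN (val : fseq R -> (int -> R))).
Qed.

Lemma fseqZ a u n : (a *: u : fseq R) n = a * u n.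
Proof.
suff -> : fsval (a *: u) = a *: fsval u by [].
exact: (linearZ_LR (val : fseq R -> (int -> R))).
Qed.

Definition window N (u v : int -> R) : R :=
  \sum_(i < N.*2.+1) u (i%:Z - N%:Z) * v (i%:Z - N%:Z).

Lemma windowS N (u v : int -> R) : window N.+1 u v =
  u (- N.+1%:Z) * v (- N.+1%:Z) + window N u v + u N.+1%:Z * v N.+1%:Z.
Proof.
rewrite /window doubleS big_ord_recl big_ord_recr /= addrA.
congr (_ + _ + _).
- by congr (u _ * v _); lia.
- by apply: eq_bigr => i _; rewrite /bump /=; congr (u _ * v _); lia.
- by rewrite /bump /=; congr (u _ * v _); lia.
Qed.

Lemma window_supported N M (u v : int -> R) :
  supported N u -> (N <= M)%N -> window M u v = window N u v.
Proof.
move=> uN /subnK <-; elim: (M - N)%N => [//|k IH].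
by rewrite addSn windowS IH !uN ?mul0r ?add0r ?addr0 //; lia.
Qed.

Lemma windowC N (u v : int -> R) : window N u v = window N v u.
Proof. by apply: eq_bigr => i _; rewrite mulrC. Qed.

Lemma window_ge0 N (u : int -> R) : 0 <= window N u u.
Proof. by apply: sumr_ge0 => i _; rewrite -expr2 sqr_ge0. Qed.

Lemma sqr_le_window N (u : int -> R) (n : int) :
  (`|n| <= N)%N -> u n ^+ 2 <= window N u u.
Proof.
move=> nN; have lt : (absz (n + N%:Z)%R < N.*2.+1)%N by lia.
rewrite /window (bigD1 (Ordinal lt)) //=.
have -> : (absz (n + N%:Z))%:Z - N%:Z = n by lia.
by rewrite expr2 lerDl; apply: sumr_ge0 => i _; rewrite -expr2 sqr_ge0.
Qed.

(** The inner product is a finite sum over any window that contains the support;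
    some such window has to be chosen for the definition. *)
Definition supp_bound u := projT1 (cid (fseqP u)).

Lemma supp_boundP u : supported (supp_bound u) u.
Proof. exact: projT2 (cid (fseqP u)). Qed.

Definition ip u v := window (supp_bound u) u v.

Lemma ip_window N u v : supported N u -> ip u v = window N u v.
Proof.
move=> uN; rewrite -(window_supported v uN (leq_maxl N (supp_bound u))).
by rewrite (window_supported v (@supp_boundP u) (leq_maxr N _)).
Qed.

Lemma supported_common u v : exists N, supported N u /\ supported N v.
Proof.
have [N uN] := fseqP u; have [M vM] := fseqP v; exists (maxn N M).
by split; [apply: supported_le uN; exact: leq_maxl |
  apply: supported_le vM; exact: leq_maxr].
Qed.

Lemma ipC u v : ip u v = ip v u.
Proof.
have [N [uN vN]] := supported_common u v.
by rewrite (ip_window _ uN) (ip_window _ vN) windowC.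
Qed.

Lemma ipDl u v w : ip (u + v) w = ip u w + ip v w.
Proof.
have [N [uN vN]] := supported_common u v.
have uvN : supported N (u + v : fseq R) by move=> n Nn; rewrite fseqD uN ?vN ?addr0.
rewrite (ip_window _ uN) (ip_window _ vN) (ip_window _ uvN) -big_split /=.
by apply: eq_bigr => i _; rewrite -mulrDl -fseqD.
Qed.

Lemma ipZl a u v : ip (a *: u) v = a * ip u v.
Proof.
have [N uN] := fseqP u.
have auN : supported N (a *: u : fseq R) by move=> n Nn; rewrite fseqZ uN ?mulr0.
rewrite (ip_window _ uN) (ip_window _ auN) mulr_sumr.
by apply: eq_bigr => i _; rewrite mulrA -fseqZ.
Qed.

Lemma ip_ge0 u : 0 <= ip u u.
Proof. exact: window_ge0. Qed.

Lemma window_le_ip N u : window N u u <= ip u u.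
Proof.
have [M uM] := fseqP u; rewrite (ip_window _ uM).
have [NM|MN] := leqP N M; last by rewrite (window_supported _ uM (ltnW MN)).
rewrite -(subnK NM); elim: (M - N)%N => [//|k IH].
rewrite addSn windowS -!expr2 (le_trans IH) // -addrA addrCA lerDl.
by rewrite addr_ge0 ?sqr_ge0.
Qed.

Lemma sqr_le_ip u n : u n ^+ 2 <= ip u u.
Proof. exact: le_trans (sqr_le_window u (leqnn _)) (window_le_ip _ _). Qed.

Lemma fseq_eq u v : (forall n, u n = v n) -> u = v.
Proof. by move=> uv; apply: val_inj; apply/funext. Qed.

Lemma fshift_subproof (k : int) u : (fun n => u (n + k)) \in @fs_pred R.
Proof.
have [N uN] := fseqP u; apply/fs_predP; exists (N + absz k)%N => n Nn.
by apply: uN; lia.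
Qed.
Definition fshift k u := FSeq (fshift_subproof k u).

Lemma fmul_subproof (V : int -> R) u : (fun n => V n * u n) \in @fs_pred R.
Proof.
by have [N uN] := fseqP u; apply/fs_predP; exists N => n Nn; rewrite uN ?mulr0.
Qed.
Definition fmul V u := FSeq (fmul_subproof V u).

Definition fharper V u := fshift 1 u + fshift (-1) u + fmul V u.

Lemma fharperE V u n : fharper V u n = u (n + 1) + u (n - 1) + V n * u n.
Proof. by rewrite /fharper !fseqD. Qed.

Lemma ip_shift u v : ip (fshift 1 u) v = ip u (fshift (-1) v).
Proof.
have [N [uN vN]] := supported_common u v.
have uN2 : supported N.+2 u by apply: supported_le uN; lia.
have sN2 : supported N.+2 (fshift 1 u) by move=> n Nn /=; apply: uN; lia.
rewrite (ip_window _ uN2) (ip_window _ sN2) /window doubleS.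
rewrite big_ord_recr [RHS]big_ord_recl /= vN ?mulr0 ?addr0; last by lia.
rewrite uN ?mul0r ?add0r; last by lia.
by apply: eq_bigr => i _; rewrite /bump /=; congr (u _ * v _); lia.
Qed.

Lemma ip_fshift k u v : ip (fshift k u) (fshift k v) = ip u v.
Proof.
have s0 w : fshift 0 w = w by apply: fseq_eq => n /=; rewrite addr0.
have sK j w : fshift (-1) (fshift j w) = fshift (j - 1) w.
  by apply: fseq_eq => n /=; congr (w _); lia.
have sS j w : fshift 1 (fshift j w) = fshift (j + 1) w.
  by apply: fseq_eq => n /=; congr (w _); lia.
have step j x y : ip (fshift (j + 1) x) (fshift (j + 1) y) = ip (fshift j x) (fshift j y).
  by rewrite -!sS ip_shift sK subrr s0.
case: k => n.
  by elim: n => [|n IH]; [rewrite !s0 | rewrite -IH -(step n%:Z); congr (ip (fshift _ _) (fshift _ _)); lia].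
elim: n => [|n IH]; rewrite -step; first by rewrite !s0.
by rewrite -IH; congr (ip (fshift _ _) (fshift _ _)); lia.
Qed.

Lemma ip_fmul_le V M u : (forall n, `|V n| <= M) ->
  ip (fmul V u) (fmul V u) <= M ^+ 2 * ip u u.
Proof.
move=> VM; have M0 : 0 <= M by apply: le_trans (VM 0).
have [N uN] := fseqP u.
have cN : supported N (fmul V u) by move=> n Nn /=; rewrite uN ?mulr0.
rewrite (ip_window _ cN) (ip_window _ uN) mulr_sumr; apply: ler_sum => i _ /=.
rewrite mulrACA -!expr2; apply: ler_wpM2r; first exact: sqr_ge0.
by rewrite -[_ ^+ 2]real_normK ?num_real // ler_pXn2r ?nnegrE.
Qed.

Lemma fharper_bounded_symmetric V M : (forall n, `|V n| <= M) ->
  bounded_symmetric ip (3 * (2 + M ^+ 2)) (fharper V).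
Proof.
move=> VM; split.
- by move=> u v; apply: fseq_eq => n; rewrite !(fharperE, fseqD); ring.
- by move=> a u; apply: fseq_eq => n; rewrite !(fharperE, fseqZ); ring.
- move=> u v.
  have ipDr x y z : ip x (y + z) = ip x y + ip x z by rewrite ![ip x _]ipC ipDl.
  have e2 : ip (fshift (-1) u) v = ip u (fshift 1 v).
    by rewrite ipC -ip_shift ipC.
  have e3 : ip (fmul V u) v = ip u (fmul V v).
    have [N [uN vN]] := supported_common u v.
    have fu : supported N (fmul V u) by move=> n Nn /=; rewrite uN ?mulr0.
    rewrite (ip_window _ fu) (ip_window _ uN).
    by apply: eq_bigr => i _ /=; ring.
  by rewrite /fharper !ipDl !ipDr ip_shift e2 e3; congr (_ + _); rewrite addrC.
- move=> u; have M0 : 0 <= M by apply: le_trans (VM 0).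
  have [N uN] := fseqP u.
  set a := fshift 1 u; set b := fshift (-1) u; set c := fmul V u.
  have uN1 : supported N.+1 u by apply: supported_le uN; lia.
  have aN : supported N.+1 a by move=> n Nn; apply: uN; lia.
  have bN : supported N.+1 b by move=> n Nn; apply: uN; lia.
  have cN : supported N.+1 c by move=> n Nn /=; rewrite uN1 ?mulr0.
  have AN : supported N.+1 (fharper V u).
    by move=> n Nn; rewrite /fharper !fseqD aN ?bN ?cN ?addr0.
  have : ip (fharper V u) (fharper V u) <= 3 * (ip a a + ip b b + ip c c).
    rewrite (ip_window _ AN) (ip_window _ aN) (ip_window _ bN) (ip_window _ cN).
    rewrite -!big_split mulr_sumr; apply: ler_sum => i _.
    move: (_ - _) => n.
    have -> : fharper V u n = a n + b n + c n by rewrite fharperE.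
    set x := a _; set y := b _; set z := c _.
    rewrite -[leRHS]/(3 * (x * x + y * y + z * z)).
    have := sqr_ge0 (x - y); have := sqr_ge0 (x - z); have := sqr_ge0 (y - z); lra.
  rewrite {1}/a {1}/b !ip_fshift => H; apply: le_trans H _.
  have := ip_fmul_le u VM; rewrite -/c.
  lra.
Qed.

End FiniteSequenceTheory.

(** * Isolated energies *)

Section IsolatedFibre.
Variable R : realType.

(** Pigeonhole on the fractional parts of the multiples of (N + 1) h; the factor
    N + 1 makes the difference of two indices exceed N. *)
Lemma near_period (h mu : R) (N : nat) : 0 < mu -> exists (n : nat) (k : int),
  (N < n)%N /\ `|n%:R * h - k%:~R| <= mu.
Proof.
move=> mu0; set Q := (Num.truncn mu^-1).+1.
have Q0 : 0 < Q%:R :> R by rewrite ltr0n.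
have Qmu : Q%:R^-1 <= mu.
  by rewrite -[leRHS]invrK lef_pV2 ?posrE ?invr_gt0 //; apply/ltW/truncnS_gt.
pose x (j : nat) := fracpart (j%:R * (N.+1%:R * h)) * Q%:R.
have x_ge0 j : 0 <= x j.
  by apply: mulr_ge0 => //; have /andP[] := fracpart_itv (j%:R * (N.+1%:R * h)).
have xQ j : (Num.truncn (x j) < Q)%N.
  rewrite truncn_lt_nat // /x gtr_pMl //.
  by have /andP[] := fracpart_itv (j%:R * (N.+1%:R * h)).
pose f (j : 'I_Q.+1) : 'I_Q := Ordinal (xQ j).
have : ~~ injectiveb f.
  apply/negP => /injectiveP /leq_card; by rewrite !card_ord ltnn.
case/injectivePn => i [j ij fij].
wlog lt_ij : i j ij fij / (i < j)%N.
  move=> H; have [|ji|e] := ltngtP i j; first exact: H.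
    by apply: (H j i) => //; rewrite eq_sym.
  by move: ij; rewrite -val_eqE /= e eqxx.
have tij : Num.truncn (x i) = Num.truncn (x j) by have := congr1 val fij.
exists ((j - i) * N.+1)%N.
exists (Num.floor (j%:R * (N.+1%:R * h)) - Num.floor (i%:R * (N.+1%:R * h))); split.
  by apply: leq_pmull; rewrite subn_gt0.
apply: le_trans Qmu.
have -> : ((j - i) * N.+1)%:R * h - (Num.floor (j%:R * (N.+1%:R * h)) -
     Num.floor (i%:R * (N.+1%:R * h)))%:~R = (x j - x i) / Q%:R.
  rewrite /x -mulrBl mulfK ?gt_eqF // /fracpart natrM natrB ?(ltnW lt_ij) // intrD mulrNz.
  by ring.
rewrite normrM [X in _ * X]gtr0_norm ?invr_gt0 // ler_piMl ?invr_ge0 //.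
have /andP[a1 a2] := truncn_itv (x_ge0 i); have /andP[b1 b2] := truncn_itv (x_ge0 j).
rewrite tij -natr1 in a1 a2; rewrite -natr1 in b2.
by rewrite ler_norml; apply/andP; split; lra.
Qed.

Lemma geometric_cvg (a : nat -> R) (c q : R) : 0 <= q < 1 ->
  (forall n, `|a n.+1 - a n| <= c * q ^+ n) -> cvgn a.
Proof.
move=> /andP[q0 q1] H.
have c0 : 0 <= c by have := H 0%N; rewrite expr0 mulr1; apply: le_trans.
have S : cvgn (series (telescope a)).
  apply: normed_cvg; apply: (series_le_cvg _ _ H) => [n|n|].
  - exact: normr_ge0.
  - by rewrite mulr_ge0 // exprn_ge0.
  - by apply: (@is_cvg_geometric_series _ c q); rewrite ger0_norm.
have -> : a = (fun n => series (telescope a) n + a 0%N).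
  by apply/funext => n; rewrite telescopeK /= subrK.
by apply: is_cvgD => //; exact: is_cvg_cst.
Qed.

Lemma cvg_window N (a : nat -> int -> R) (b : int -> R) :
  (forall n, a k n @[k --> \oo] --> b n) ->
  window N (a k) (a k) @[k --> \oo] --> window N b b.
Proof.
move=> ab; apply: cvg_big => [|i _]; first exact: add_continuous.
by apply: cvgM; exact: ab.
Qed.

(** The limit of the damped sequence: an exact solution close to v. *)
Lemma exact_solution (V : int -> R) (M eps : R) (v : fseq R)
  (A := fharper V) (K := 3 * (2 + M ^+ 2)) (q := Num.sqrt (1 - eps ^+ 2 / K)) :
  (forall n, `|V n| <= M) -> 0 < eps ->
  (forall e, 0 < `|e| < eps -> exists2 d, 0 < d &
    forall u, d * ip u u <= ip (A u - e *: u) (A u - e *: u)) ->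
  exists w : int -> R,
  [/\ forall n, w (n + 1) + w (n - 1) + V n * w n = 0,
      forall N, window N w w <= ip v v &
      forall N, window N (w - v) (w - v) <=
        (K^-1 * ipn (@ip R) (A (A v)) / (1 - q)) ^+ 2].
Proof.
move=> VM eps0 gap.
have bA : bounded_symmetric (@ip R) K A := fharper_bounded_symmetric VM.
have K0 : 0 < K by rewrite mulr_gt0 // ltr_wpDr ?sqr_ge0.
have q01 : 0 <= q < 1.
  rewrite /q sqrtr_ge0 /= -{2}[1]sqrtr1 ltr_sqrt // ltrBlDr ltrDl.
  by rewrite divr_gt0 // exprn_gt0.
set vn := fun k => iter k (damp K A) v.
have point (u : fseq R) n : `|u n| <= ipn (@ip R) u.
  rewrite -(ler_pXn2r (n:=2)) ?nnegrE ?sqrtr_ge0 //.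
  by rewrite real_normK ?num_real // sqr_sqrtr ?ip_ge0 // sqr_le_ip.
have cv n : cvgn (fun k => vn k n).
  apply: (geometric_cvg q01) => k.
  have -> : vn k.+1 n - vn k n = (vn k.+1 - vn k : fseq R) n by rewrite fseqD fseqN.
  apply: le_trans (point _ _) _.
  exact: (iter_damp_incr (@ipC R) (@ipDl R) (@ipZl R) (@ip_ge0 R) K0 bA eps0 gap).
set w := fun n => limn (fun k => vn k n).
have lim n : (fun k => vn k n) @ \oo --> w n by exact: cv.
exists w; split.
- move=> n.
  have l0 : (fun k => A (vn k) n) @ \oo --> w (n + 1) + w (n - 1) + V n * w n.
    have -> : (fun k => A (vn k) n) =
        (fun k => vn k (n + 1) + vn k (n - 1) + V n * vn k n).
      by apply/funext => k; rewrite /A fharperE.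
    by apply: cvgD; [apply: cvgD | apply: cvgM => //; exact: cvg_cst].
  have l1 : (fun k => A (vn k) n) @ \oo --> (0 : R).
    apply/cvgrPdist_le => e e0.
    have g0 : (fun k => ipn (@ip R) (A (A v)) * ipn (@ip R) v * q ^+ k) @ \oo --> (0 : R).
      rewrite -[X in _ --> X](mulr0 (ipn (@ip R) (A (A v)) * ipn (@ip R) v)).
      apply: cvgM; first exact: cvg_cst.
      by apply: cvg_expr; rewrite ger0_norm; case/andP: q01.
    have e2 : 0 < e ^+ 2 by rewrite exprn_gt0.
    move/cvgrPdist_le : g0 => /(_ _ e2); apply: filterS => k.
    rewrite !sub0r !normrN => ke.
    rewrite -(ler_pXn2r (n:=2)) ?nnegrE ?(ltW e0) // real_normK ?num_real //.
    apply: le_trans (sqr_le_ip _ _) _; apply: le_trans ke.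
    apply: le_trans (ler_norm _).
    exact: (iter_damp_ker (@ipC R) (@ipDl R) (@ipZl R) (@ip_ge0 R) K0 bA eps0 gap).
  exact: (cvg_unique _ l0 l1).
- move=> N.
  have l0 : (fun k => window N (vn k) (vn k)) @ \oo --> window N w w.
    exact: cvg_window.
  apply: (ler_cvg_to l0 (@cvg_cst _ _ _ _ _)); apply: nearW => k.
  apply: le_trans (window_le_ip _ _) _.
  exact: (iter_damp_le (@ipC R) (@ipDl R) (@ipZl R) (@ip_ge0 R) K0 bA).
- move=> N.
  have l0 : (fun k => window N (vn k - v : fseq R) (vn k - v : fseq R)) @ \oo -->
      window N (w - v) (w - v).
    apply: cvg_window => n.
    have l1 : (fun k => (vn k - v : fseq R) n) @ \oo --> w n - v n.
      have -> : (fun k => (vn k - v : fseq R) n) = (fun k => vn k n - v n).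
        by apply/funext => k; rewrite fseqD fseqN.
      by apply: cvgB => //; exact: cvg_cst.
    exact: l1.
  apply: (ler_cvg_to l0 (@cvg_cst _ _ _ _ _)); apply: nearW => k.
  apply: le_trans (window_le_ip _ _) _.
  have := iter_damp_close (@ipC R) (@ipDl R) (@ipZl R) (@ip_ge0 R) K0 bA eps0 gap k v.
  have := sqrtr_ge0 (ip (vn k - v : fseq R) (vn k - v)).
  rewrite -[X in _ -> _ -> X <= _]sqr_sqrtr ?ip_ge0 // => n0 nk.
  by rewrite ler_pXn2r ?nnegrE //; apply: le_trans nk.
Qed.

Lemma recurrence_zero (V z : int -> R) :
  (forall n, z (n + 1) + z (n - 1) + V n * z n = 0) ->
  z 0 = 0 -> z 1 = 0 -> forall n, z n = 0.
Proof.
move=> rec z0 z1.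
have pos (k : nat) : z k%:Z = 0 /\ z k.+1%:Z = 0.
  elim: k => [//|k [e1 e2]]; split=> //.
  have := rec k.+1%:Z.
  have -> : k.+1%:Z + 1 = k.+2%:Z by lia.
  have -> : k.+1%:Z - 1 = k%:Z by lia.
  by rewrite e1 e2 mulr0 !addr0.
have neg (k : nat) : z (- k%:Z) = 0 /\ z (1 - k%:Z) = 0.
  elim: k => [|k [e1 e2]]; first by rewrite oppr0 addr0.
  have -> : 1 - k.+1%:Z = - k%:Z by lia.
  split=> //; have := rec (- k%:Z); rewrite [- k%:Z + 1]addrC e1 e2 mulr0 add0r addr0.
  by have -> : - k%:Z - 1 = - k.+1%:Z by lia.
move=> n; case: (intP n) => [//|k|k]; first by case: (pos k.+1).
by case: (neg k.+1).
Qed.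

(** Two square summable solutions have Wronskian zero, hence are proportional;
    they cannot be close to two orthogonal vectors of the same length. *)
Lemma square_summable_dependent (V w1 w2 : int -> R) (v1 v2 : fseq R) (s : R) :
  0 < s -> ip v1 v1 = s -> ip v2 v2 = s -> (forall n, v1 n * v2 n = 0) ->
  (forall n, w1 (n + 1) + w1 (n - 1) + V n * w1 n = 0) ->
  (forall n, w2 (n + 1) + w2 (n - 1) + V n * w2 n = 0) ->
  (forall N, window N w1 w1 <= s) -> (forall N, window N w2 w2 <= s) ->
  (forall N, window N (w1 - v1) (w1 - v1) <= s / 4) ->
  (forall N, window N (w2 - v2) (w2 - v2) <= s / 4) -> False.
Proof.
move=> s0 s1 s2 v12 r1 r2 b1 b2 c1 c2.
set W := fun n : int => w1 (n + 1) * w2 n - w1 n * w2 (n + 1).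
have Wc (n : nat) : W n%:Z = W 0.
  elim: n => [//|n <-]; rewrite /W.
  have := r1 n.+1%:Z; have := r2 n.+1%:Z.
  have -> : n.+1%:Z - 1 = n%:Z by lia.
  have -> : n%:Z + 1 = n.+1%:Z by lia.
  move=> /eqP; rewrite -addrA addr_eq0 => /eqP ->.
  move=> /eqP; rewrite -addrA addr_eq0 => /eqP ->; ring.
have half (u : int -> R) N : (forall N, window N u u <= s) -> \sum_(i < N) u i%:Z ^+ 2 <= s.
  move=> bu; apply: le_trans (bu N); rewrite /window.
  have -> : N.*2.+1 = (N + N.+1)%N by lia.
  rewrite big_split_ord /= -[leLHS]add0r; apply: lerD.
    by apply: sumr_ge0 => i _; rewrite -expr2 sqr_ge0.
  rewrite big_ord_recr /= -[leLHS]addr0; apply: lerD; last by rewrite -expr2 sqr_ge0.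
  apply: ler_sum => i _; rewrite -expr2; have -> : (N + i)%:Z - N%:Z = i%:Z by lia.
  exact: lexx.
have half1 (u : int -> R) N : (forall N, window N u u <= s) ->
    \sum_(i < N) u (i%:Z + 1) ^+ 2 <= s.
  move=> bu; apply: le_trans (half u N.+1 bu); rewrite big_ord_recl /= -[leLHS]add0r.
  apply: lerD; first exact: sqr_ge0.
  by apply: ler_sum => i _; rewrite /bump /=; have -> : i%:Z + 1 = (1 + i)%N%:Z by lia.
have W0 : W 0 = 0.
  have WN N : N%:R * `|W 0| <= 2 * s.
    have -> : N%:R * `|W 0| = \sum_(i < N) `|W i%:Z|.
      by rewrite (eq_bigr (fun=> `|W 0|)) ?sumr_const ?card_ord ?mulr_natl // => i _; rewrite Wc.
    apply: (@le_trans _ _ (2^-1 * (\sum_(i < N) w1 (i%:Z + 1) ^+ 2 + \sum_(i < N) w2 i%:Z ^+ 2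
       + \sum_(i < N) w1 i%:Z ^+ 2 + \sum_(i < N) w2 (i%:Z + 1) ^+ 2))).
      rewrite -!big_split mulr_sumr; apply: ler_sum => i _.
      rewrite -[leRHS]/(2^-1 * (w1 (i%:Z + 1) ^+ 2 + w2 i%:Z ^+ 2 + w1 i%:Z ^+ 2 + w2 (i%:Z + 1) ^+ 2)) /W.
      set a := w1 (_ + _); set b := w2 i; set c := w1 i; set d := w2 (_ + _).
      have := sqr_ge0 (a - b); have := sqr_ge0 (a + b).
      have := sqr_ge0 (c - d); have := sqr_ge0 (c + d).
      by rewrite ler_norml => *; apply/andP; split; lra.
    have := half1 w1 N b1; have := half w2 N b2; have := half w1 N b1; have := half1 w2 N b2.
    lra.
  apply/eqP; rewrite -normr_le0 leNgt; apply/negP => Wp.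
  have := WN (Num.truncn (2 * s / `|W 0|)).+1.
  by rewrite leNgt -ltr_pdivrMr // truncnS_gt.
have [a [b [ab0 e0 e1]]] : exists a b : R, [/\ 0 < a ^+ 2 + b ^+ 2,
    a * w1 0 + b * w2 0 = 0 & a * w1 1 + b * w2 1 = 0].
  have sqp (x y : R) : (x != 0) || (y != 0) -> 0 < x ^+ 2 + y ^+ 2.
    by case/orP => h; [rewrite ltr_pwDl | rewrite ltr_wpDl];
      rewrite ?sqr_ge0 // exprn_even_gt0 ?h.
  have [/sqp h|] := boolP ((w2 0 != 0) || (w1 0 != 0)).
    exists (w2 0), (- w1 0); rewrite sqrrN; split=> //; first by ring.
    by rewrite -W0 /W add0r; ring.
  rewrite negb_or !negbK => /andP[/eqP z2 /eqP z1].
  have [/sqp h|] := boolP ((w2 1 != 0) || (w1 1 != 0)).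
    by exists (w2 1), (- w1 1); rewrite sqrrN z1 z2; split=> //; ring.
  rewrite negb_or !negbK => /andP[/eqP z3 /eqP z4].
  exists 1, 0; rewrite z1 z2 z3 z4; split; try ring.
  by rewrite expr1n expr0n addr0.
have zz n : a * w1 n + b * w2 n = 0.
  apply: (recurrence_zero (z := fun n => a * w1 n + b * w2 n) (V := V)) => // k /=.
  transitivity (a * (w1 (k + 1) + w1 (k - 1) + V k * w1 k) +
    b * (w2 (k + 1) + w2 (k - 1) + V k * w2 k)); first by ring.
  by rewrite r1 r2 !mulr0 addr0.
have [N [N1 N2]] := supported_common v1 v2.
have lo : (a ^+ 2 + b ^+ 2) * s = window N (fun n => a * v1 n + b * v2 n) (fun n => a * v1 n + b * v2 n).
  rewrite mulrDl -{1}s1 -s2 (ip_window _ N1) (ip_window _ N2) !mulr_sumr -big_split.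
  apply: eq_bigr => i _; move: (_ - _) => n.
  transitivity (a ^+ 2 * (v1 n * v1 n) + b ^+ 2 * (v2 n * v2 n) + 2 * a * b * (v1 n * v2 n)).
    by rewrite v12 mulr0 addr0.
  by ring.
have up : window N (fun n => a * v1 n + b * v2 n) (fun n => a * v1 n + b * v2 n) <=
   2 * (a ^+ 2 * window N (w1 - v1) (w1 - v1) + b ^+ 2 * window N (w2 - v2) (w2 - v2)).
  rewrite !mulr_sumr -big_split mulr_sumr; apply: ler_sum => i _; move: (_ - _) => n.
  rewrite -[leRHS]/(2 * (a ^+ 2 * ((w1 n - v1 n) * (w1 n - v1 n)) + b ^+ 2 * ((w2 n - v2 n) * (w2 n - v2 n)))).
  have -> : a * v1 n + b * v2 n = - (a * (w1 n - v1 n) + b * (w2 n - v2 n)).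
    by apply/eqP; rewrite -subr_eq0 opprK; apply/eqP; rewrite -[RHS](zz n); ring.
  set x := w1 n - _; set y := w2 n - _.
  by have := sqr_ge0 (a * x - b * y); lra.
have u1 : a ^+ 2 * window N (w1 - v1) (w1 - v1) <= a ^+ 2 * (s / 4).
  by apply: ler_wpM2l; rewrite ?sqr_ge0.
have u2 : b ^+ 2 * window N (w2 - v2) (w2 - v2) <= b ^+ 2 * (s / 4).
  by apply: ler_wpM2l; rewrite ?sqr_ge0.
have p : 0 < (a ^+ 2 + b ^+ 2) * s by rewrite mulr_gt0.
lra.
Qed.

(** If E is isolated in the spectrum and A u = (H - E) u is small, then so is
    A u' for a translate u' of u by a near period of the potential; exact
    solutions close to u and to u' contradict the previous lemma. *)
Lemma isolated_fibre (w : R -> R) (h M Lip eps : R)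
  (A := fun x => fharper (fun n => w (x + n%:~R * h))) :
  (forall x, `|w x| <= M) -> 0 < Lip ->
  (forall x y, `|w x - w y| <= Lip * `|x - y|) ->
  (forall x (k : int), w (x + k%:~R) = w x) -> 0 < eps ->
  (forall x e, 0 < `|e| < eps -> exists2 d, 0 < d &
    forall u, d * ip u u <= ip (A x u - e *: u) (A x u - e *: u)) ->
  exists2 d, 0 < d & forall x u, d * ip u u <= ip (A x u) (A x u).
Proof.
move=> wM L0 wL wp eps0 gap.
set K := 3 * (2 + M ^+ 2); set q := Num.sqrt (1 - eps ^+ 2 / K).
have K0 : 0 < K by rewrite mulr_gt0 // ltr_wpDr ?sqr_ge0.
have q1 : 0 < 1 - q.
  rewrite subr_gt0 /q -{2}[1]sqrtr1 ltr_sqrt // ltrBlDr ltrDl.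
  by rewrite divr_gt0 // exprn_gt0.
have sK : 0 < Num.sqrt K by rewrite sqrtr_gt0.
set eta := K * (1 - q) / (4 * Num.sqrt K).
have eta0 : 0 < eta by rewrite divr_gt0 // mulr_gt0.
exists (eta ^+ 2); first by rewrite exprn_gt0.
move=> x u; rewrite leNgt; apply/negP => small.
have bA : bounded_symmetric (@ip R) K (A x).
  by apply: fharper_bounded_symmetric => n; exact: wM.
set N := ipn (@ip R).
have N_sqr v : N v ^+ 2 = ip v v by rewrite sqr_sqrtr ?ip_ge0.
have N_ge0 v : 0 <= N v by exact: sqrtr_ge0.
have N_le v c : 0 <= c -> ip v v <= c ^+ 2 * ip u u -> N v <= c * N u.
  move=> c0 H; rewrite -(ler_pXn2r (n:=2)) ?nnegrE ?mulr_ge0 //.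
  by rewrite exprMn !N_sqr.
have s0 : 0 < ip u u.
  rewrite lt_def ip_ge0 andbT; apply: contraTneq small => ->.
  by rewrite mulr0 ltNge ip_ge0.
have close v : N (A x v) <= 2 * eta * N u ->
    (K^-1 * N (A x (A x v)) / (1 - q)) ^+ 2 <= ip u u / 4.
  move=> H.
  have H2 : N (A x (A x v)) <= Num.sqrt K * N (A x v).
    rewrite -(ler_pXn2r (n:=2)) ?nnegrE ?mulr_ge0 ?(ltW sK) //.
    by rewrite exprMn !N_sqr sqr_sqrtr ?(ltW K0) //; exact: (bs_bd bA).
  have -> : ip u u / 4 = (N u / 2) ^+ 2 by rewrite -N_sqr; field.
  rewrite ler_pXn2r ?nnegrE ?divr_ge0 ?mulr_ge0 ?invr_ge0 ?(ltW K0) ?(ltW q1) //.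
  rewrite ler_pdivrMr // ler_pdivrMl //.
  apply: le_trans H2 _; apply: le_trans (ler_wpM2l (ltW sK) H) _.
  rewrite le_eqVlt; apply/orP; left; apply/eqP; rewrite /eta.
  by field; rewrite gt_eqF.
have [N0 uN0] := fseqP u.
have [n [k [Nn nk]]] := near_period h N0.*2 (divr_gt0 eta0 L0).
set u' := fshift (- n%:Z) u.
have uu' : ip u' u' = ip u u by rewrite ip_fshift.
have disj m : u m * u' m = 0.
  have [Nm|mN] := ltnP N0 (absz m); first by rewrite uN0 ?mul0r.
  by rewrite /u' /= [u (m - _)]uN0 ?mulr0 //; lia.
set V := fun m : int => w (x + m%:~R * h).
set D := fun m : int => V m - V (m - n%:Z).
have DM m : `|D m| <= eta.
  rewrite /D /V -(wp (x + (m - n%:Z)%:~R * h) k); apply: le_trans (wL _ _) _.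
  rewrite mulrC -ler_pdivlMr //; apply: le_trans nk.
  by rewrite intrB -pmulrn le_eqVlt; apply/orP; left; apply/eqP; congr `|_|; ring.
have Au' : A x u' = fshift (- n%:Z) (A x u) + fmul D u'.
  apply: fseq_eq => m; rewrite fseqD.
  rewrite -[fshift _ (A x u) m]/(A x u (m - n%:Z)) -[fmul D u' m]/(D m * u' m).
  rewrite /A !fharperE -/(V m) -/(V (m - n%:Z)) /D /u'.
  rewrite -![fshift _ u _]/(u (_ - n%:Z)).
  have -> : m + 1 - n%:Z = m - n%:Z + 1 by ring.
  have -> : m - 1 - n%:Z = m - n%:Z - 1 by ring.
  by ring.
have sm : N (A x u) <= eta * N u by apply: N_le; exact: ltW.
have sm1 : N (A x u) <= 2 * eta * N u.
  by apply: le_trans sm _; apply: ler_wpM2r => //; lra.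
have sm2 : N (A x u') <= 2 * eta * N u.
  rewrite Au'; apply: le_trans (ipnD (@ipC R) (@ipDl R) (@ipZl R) (@ip_ge0 R) _ _) _.
  have -> : 2 * eta * N u = eta * N u + eta * N u by ring.
  apply: lerD; first by rewrite /ipn ip_fshift.
  by apply: N_le; [exact: ltW | rewrite -uu'; exact: ip_fmul_le].
have [w1 [r1 b1 c1]] := @exact_solution V M eps u (fun m => wM _) eps0 (gap x).
have [w2 [r2 b2 c2]] := @exact_solution V M eps u' (fun m => wM _) eps0 (gap x).
apply: (square_summable_dependent s0 erefl uu' disj r1 r2 b1) => [m|m|m].
- by rewrite -uu'.
- exact: le_trans (c1 m) (close _ sm1).
- exact: le_trans (c2 m) (close _ sm2).
Qed.

End IsolatedFibre.

(** * From the fibres to the line *)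

Section SquareIntegrable.
Variable R : realType.
Local Notation mu := (@lebesgue_measure R).

Lemma measurable_shift (a : R) : measurable_fun [set: R] (fun x : R => x + a).
Proof. by apply: measurable_funD => //; exact: measurable_cst. Qed.

Lemma pushforward_shift (a : R) (A : set R) : measurable A ->
  pushforward mu (fun x : measurableTypeR R => (x + a : measurableTypeR R)) A = mu A.
Proof.
move=> mA; apply/esym/lebesgue_measure_unique => //=.
  exact: measurable_shift.
move=> mf X [[c d]] _ <-; rewrite /pushforward /=.
have -> : (fun x : R => x + a) @^-1` `]c, d]%classic = `]c - a, d - a]%classic.
  by apply/seteqP; split=> x /=; rewrite !in_itv /= ltrBlDr lerBrDr.
by rewrite !lebesgue_measure_itv /= !lte_fin ltrD2r -!EFinB opprB addrA subrK.
Qed.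

Lemma ge0_integral_shift (a : R) (f : R -> \bar R) : measurable_fun setT f ->
  (forall x, (0 <= f x)%E) ->
  (\int[mu]_x f (x + a)%R = \int[mu]_x f x)%E.
Proof.
move=> mf f0.
have mS : measurable_fun setT (fun x : measurableTypeR R => (x + a : measurableTypeR R)).
  exact: measurable_shift.
have := @ge0_integral_pushforward _ _ _ _ _ _ mS mu setT f measurableT mf (fun y _ => f0 y).
rewrite preimage_setT => <-.
apply: eq_measure_integral => A mA _.
exact: pushforward_shift.
Qed.

Lemma aeS (P Q : R -> Prop) : (forall x, P x -> Q x) ->
  {ae mu, forall x, P x} -> {ae mu, forall x, Q x}.
Proof. by move=> PQ; apply: (@filterS _ _ (ae_filter_ringOfSetsType mu)). Qed.

Lemma aeI (P Q : R -> Prop) : {ae mu, forall x, P x} -> {ae mu, forall x, Q x} ->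
  {ae mu, forall x, P x /\ Q x}.
Proof. by apply: (@filterS2 _ _ (ae_filter_ringOfSetsType mu)) => x; split. Qed.

Definition energy (f : R -> R) : \bar R := (\int[mu]_x (f x ^+ 2)%:E)%E.

Lemma energy_ge0 f : (0 <= energy f)%E.
Proof. by apply: integral_ge0 => x _; rewrite lee_fin sqr_ge0. Qed.

Lemma measurable_sqr (f : R -> R) : measurable_fun setT f ->
  measurable_fun setT (fun x : R => (f x ^+ 2)%:E).
Proof. by move=> mf; apply/measurable_EFinP; exact: measurable_funX. Qed.

Lemma measurable_fun_shift (f : R -> R) (a : R) : measurable_fun setT f ->
  measurable_fun setT (fun x : R => f (x + a)).
Proof. by move=> mf; apply: measurableT_comp => //; exact: measurable_shift. Qed.

Lemma energy_shift (f : R -> R) (a : R) : measurable_fun setT f ->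
  energy (fun x => f (x + a)) = energy f.
Proof.
move=> mf; apply: (ge0_integral_shift a (measurable_sqr mf)) => x.
by rewrite lee_fin sqr_ge0.
Qed.

(** Sums of squares along the fibres, integrated over the whole line, count
    every fibre once for each term. *)
Lemma integral_fibre_sum (f : R -> R) (h c : R) (m : nat) : measurable_fun setT f ->
  (\int[mu]_x (\sum_(i < m) f (x + (i%:R + c) * h)%R ^+ 2)%:E = m%:R%:E * energy f)%E.
Proof.
move=> mf.
under eq_integral => x _ do rewrite -sumEFin.
rewrite ge0_integral_sum //; last first.
- by move=> i x _; rewrite lee_fin sqr_ge0.
- by move=> i; apply: measurable_sqr; exact: measurable_fun_shift.
rewrite (eq_bigr (fun=> energy f)); last by move=> i _; exact: energy_shift.
elim: m => [|m IH]; first by rewrite big_ord0 mul0e.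
by rewrite big_ord_recr /= IH -natr1 EFinD ge0_muleDl ?lee_fin // mul1e.
Qed.

Section Solve.
Variables (w : R -> R) (h M : R).
Hypothesis mw : measurable_fun setT w.
Hypothesis wM : forall x, `|w x| <= M.
Let K := 3 * (2 + M ^+ 2).
Let K0 : 0 < K. Proof. by rewrite mulr_gt0 // ltr_wpDr ?sqr_ge0. Qed.

(** The operator A and its damping on functions on the line, with the bound K of
    A ^+ 2 on the fibres. *)
Definition line_harper (g : R -> R) (x : R) : R := g (x + h) + g (x - h) + w x * g x.
Definition line_damp (g : R -> R) (x : R) : R := g x - K^-1 * line_harper (line_harper g) x.

Lemma measurable_line_harper g : measurable_fun setT g -> measurable_fun setT (line_harper g).
Proof.
move=> mg; apply: measurable_funD; last exact: measurable_funM.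
by apply: measurable_funD; exact: measurable_fun_shift.
Qed.

Lemma measurable_line_damp g : measurable_fun setT g -> measurable_fun setT (line_damp g).
Proof.
move=> mg; apply: measurable_funB => //; apply: measurable_funM => //.
by do 2! apply: measurable_line_harper.
Qed.

Variable d : R.
Hypothesis d01 : 0 < d <= K / 2.
Let A x := fharper (fun n => w (x + n%:~R * h)).
Hypothesis low : forall x u, d * ip u u <= ip (A x u) (A x u).
Let q := 1 - d / K.

Let q_gt0 : 0 < q.
Proof.
case/andP: d01 => d0 dK; rewrite subr_gt0 ltr_pdivrMr // mul1r.
by apply: le_lt_trans dK _; have := K0; lra.
Qed.

Let q_lt1 : q < 1.
Proof. by case/andP: d01 => d0 dK; rewrite /q ltrBlDr ltrDl divr_gt0. Qed.

Lemma truncation_subproof (g : R -> R) x m :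
  (fun n : int => if (0 <= n) && (n < m%:Z) then g (x + n%:~R * h) else 0)
    \in @fs_pred R.
Proof.
apply/fs_predP; exists m => n mn; case: ifP => // /andP[n0 nm].
by exfalso; move: mn; lia.
Qed.
Definition truncation g x m := FSeq (truncation_subproof g x m).

Lemma ip_nat (u : fseq R) m : (forall n : int, u n != 0 -> 0 <= n < m%:Z) ->
  ip u u = \sum_(i < m) u i%:Z ^+ 2.
Proof.
move=> um.
have uS : supported m u.
  by move=> n mn; apply: contraTeq mn => /um /andP[? ?]; lia.
rewrite (ip_window _ uS) /window.
have -> : m.*2.+1 = (m + m.+1)%N by lia.
rewrite big_split_ord /= [X in X + _]big1 ?add0r => [|[i im] _].
  rewrite big_ord_recr /= [X in _ + X](_ : _ = 0) ?addr0; last first.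
    have -> : (m + m)%N%:Z - m%:Z = m%:Z by lia.
    apply/eqP; rewrite mulf_eq0 orbb; apply: contraT => /um; lia.
  apply: eq_bigr => i _ /=; rewrite expr2.
  by have -> : (m + i)%N%:Z - m%:Z = i%:Z by lia.
apply/eqP; rewrite mulf_eq0 orbb; apply: contraT => /um /=; lia.
Qed.

Lemma ip_truncation g x m :
  ip (truncation g x m) (truncation g x m) = \sum_(i < m) g (x + (i%:R + 0) * h) ^+ 2.
Proof.
rewrite (@ip_nat _ m) => [|n /=]; last by case: ifP => // _ /eqP.
by apply: eq_bigr => i _ /=; rewrite ltz_nat ltn_ord addr0.
Qed.

Lemma sum_le_ip (u : fseq R) m c : \sum_(i < m) u (i%:Z + c%:Z) ^+ 2 <= ip u u.
Proof.
have [N uN] := fseqP u.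
have uN' : supported (N + (m + c)) u by apply: supported_le uN; lia.
rewrite (ip_window _ uN') /window.
have -> : (N + (m + c)).*2.+1 = ((N + (m + c)) + (c + (m + (N + 1))))%N by lia.
rewrite big_split_ord -[leLHS]add0r; apply: lerD.
  by apply: sumr_ge0 => i _; rewrite -expr2 sqr_ge0.
rewrite big_split_ord -[leLHS]add0r; apply: lerD.
  by apply: sumr_ge0 => i _; rewrite -expr2 sqr_ge0.
rewrite big_split_ord -[leLHS]addr0; apply: lerD; last first.
  by apply: sumr_ge0 => i _; rewrite -expr2 sqr_ge0.
apply: ler_sum => i _ /=; rewrite expr2.
by have -> : (N + (m + c) + (c + i))%N%:Z - (N + (m + c))%N%:Z = i%:Z + c%:Z by lia.
Qed.

Lemma fharper_truncation g x m (j : nat) : (0 < j)%N -> (j.+1 < m)%N ->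
  A x (truncation g x m) j%:Z = line_harper g (x + j%:R * h).
Proof.
move=> j0 jm.
have T (k : int) : 0 <= k -> k < m%:Z -> truncation g x m k = g (x + k%:~R * h).
  by move=> k0 km; rewrite /= k0 km.
rewrite /A fharperE !T; try lia.
by rewrite /line_harper; congr (g _ + g _ + _); rewrite ?intrD ?intrB -?pmulrn; ring.
Qed.

(** A ^+ 2 reaches two sites away on each side, so the inner m of m + 4 sites see
    no effect of the truncation. *)
Lemma line_damp_window g x m :
  \sum_(i < m) line_damp g (x + (i%:R + 2) * h) ^+ 2 <=
  q * \sum_(i < m + 4) g (x + (i%:R + 0) * h) ^+ 2.
Proof.
have bA : bounded_symmetric (@ip R) K (A x).
  by apply: fharper_bounded_symmetric => n; exact: wM.
set u := truncation g x (m + 4).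
rewrite -ip_truncation -/u.
have le1 : ip (damp K (A x) u) (damp K (A x) u) <= q * ip u u.
  have h1 := damp_le (@ipC R) (@ipDl R) (@ipZl R) u K0 bA.
  apply: le_trans h1 _; rewrite /q mulrBl mul1r lerD2l lerN2.
  by rewrite mulrAC ler_pM2r ?invr_gt0.
apply: le_trans le1; apply: le_trans (sum_le_ip _ m 2).
apply: ler_sum => i _; rewrite le_eqVlt; apply/orP; left; apply/eqP; congr (_ ^+ 2).
rewrite /damp fseqD fseqN fseqZ /line_damp.
have -> : i%:Z + 2%:Z = (i + 2)%N%:Z by lia.
have lt_im := ltn_ord i.
have E j : (0 < j)%N -> (j.+1 < m + 4)%N -> A x u j%:Z = line_harper g (x + j%:R * h).
  exact: fharper_truncation.
congr (_ - _ * _).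
  rewrite /u /= ltz_nat; have -> : (i + 2 < m + 4)%N by lia.
  by rewrite -pmulrn natrD.
rewrite /A fharperE -/(A x).
have -> : (i + 2)%N%:Z + 1 = (i + 3)%N%:Z by lia.
have -> : (i + 2)%N%:Z - 1 = (i + 1)%N%:Z by lia.
rewrite -/(A x u) !E; try lia.
set y := x + (i%:R + 2) * h.
rewrite -[LHS]/(line_harper g (y + h) + line_harper g (y - h) + w y * line_harper g y).
by congr (line_harper g _ + line_harper g _ + w _ * line_harper g _); rewrite /y -?pmulrn natrD; ring.
Qed.

(** Integrating the previous bound gives m |B g|^2 <= q (m + 4) |g|^2, and m is
    arbitrary: the boundary terms become negligible. *)
Lemma energy_line_damp g : measurable_fun setT g -> (energy g < +oo)%E ->
  (energy (line_damp g) <= q%:E * energy g)%E.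
Proof.
move=> mg fg.
have ineq m : (m%:R%:E * energy (line_damp g) <= (q * (m + 4)%N%:R)%:E * energy g)%E.
  rewrite -(integral_fibre_sum h 2 m (measurable_line_damp mg)) EFinM -muleA.
  rewrite -(integral_fibre_sum h 0 (m + 4) mg) -ge0_integralZl ?lee_fin ?(ltW q_gt0) //.
  - apply: ge0_le_integral => //.
    + by move=> x _; rewrite lee_fin sumr_ge0 // => i _; rewrite sqr_ge0.
    + apply/measurable_EFinP; apply: measurable_sum => i.
      by apply: measurable_funX; apply: measurable_fun_shift; exact: measurable_line_damp.
    + apply/measurable_EFinP; apply: measurable_funM => //; apply: measurable_sum => i.
      by apply: measurable_funX; exact: measurable_fun_shift.
    + by move=> x _; rewrite -EFinM lee_fin; exact: line_damp_window.
  - apply/measurable_EFinP; apply: measurable_sum => i.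
    by apply: measurable_funX; exact: measurable_fun_shift.
  - by move=> x _; rewrite lee_fin sumr_ge0 // => i _; rewrite sqr_ge0.
have fgn : energy g \is a fin_num by rewrite ge0_fin_numE ?energy_ge0.
have fbn : energy (line_damp g) \is a fin_num.
  rewrite ge0_fin_numE ?energy_ge0 //; have := ineq 1%N; rewrite mul1e => H.
  by apply: le_lt_trans H _; rewrite lte_mul_pinfty // lee_fin mulr_ge0 // ltW.
rewrite -(fineK fgn) -(fineK fbn) in ineq *; move: ineq.
set J := fine (energy (line_damp g)); set I := fine (energy g) => ineq.
have I0 : 0 <= I by rewrite fine_ge0 // energy_ge0.
rewrite -EFinM lee_fin leNgt; apply/negP => JI.
have e0 : 0 < J - q * I by rewrite subr_gt0.
have := ineq (Num.truncn (4 * (q * I) / (J - q * I))).+1.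
set n := _.+1; rewrite -!EFinM lee_fin natrD leNgt => /negP; apply.
have : 4 * (q * I) < n%:R * (J - q * I) by rewrite -ltr_pdivrMr // truncnS_gt.
lra.
Qed.

Lemma energy_line_harper g : measurable_fun setT g ->
  (energy (line_harper g) <= K%:E * energy g)%E.
Proof.
move=> mg.
have m1 a : measurable_fun setT (fun x : R => (g (x + a) ^+ 2)%:E).
  by apply: measurable_sqr; exact: measurable_fun_shift.
have p1 a x : (0 <= (g (x + a) ^+ 2)%:E)%E by rewrite lee_fin sqr_ge0.
have mD : measurable_fun setT (fun x => ((M ^+ 2)%:E * (g x ^+ 2)%:E)%E).
  by apply: measurable_funeM; exact: measurable_sqr.
have pD x : (0 <= ((M ^+ 2)%:E * (g x ^+ 2)%:E))%E.
  by rewrite mule_ge0 // lee_fin sqr_ge0.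
have mS : measurable_fun setT (fun x : R => ((g (x + h) ^+ 2)%:E +
     (g (x + - h) ^+ 2)%:E + (M ^+ 2)%:E * (g x ^+ 2)%:E))%E.
  by apply: emeasurable_funD => //; apply: emeasurable_funD.
have pS x : (0 <= (g (x + h) ^+ 2)%:E +
     (g (x + - h) ^+ 2)%:E + (M ^+ 2)%:E * (g x ^+ 2)%:E)%E.
  by rewrite !adde_ge0.
have -> : (K%:E * energy g = \int[mu]_x (3%:E * ((g (x + h) ^+ 2)%:E +
     (g (x + - h) ^+ 2)%:E + (M ^+ 2)%:E * (g x ^+ 2)%:E)))%E.
  have mU : measurable_fun setT (fun x : R => ((g (x + h) ^+ 2)%:E +
     (g (x + - h) ^+ 2)%:E))%E by apply: emeasurable_funD.
  have pU x : (0 <= (g (x + h) ^+ 2)%:E + (g (x + - h) ^+ 2)%:E)%E.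
    by rewrite adde_ge0.
  rewrite (ge0_integralZl mu measurableT mS) //.
  rewrite (ge0_integralD mu measurableT (fun x _ => pU x) mU (fun x _ => pD x) mD).
  rewrite (ge0_integralD mu measurableT (fun x _ => p1 h x) (m1 h)
    (fun x _ => p1 (- h) x) (m1 (- h))).
  rewrite (ge0_integralZl mu measurableT (measurable_sqr mg)); last 2 first.
    by move=> x _; rewrite lee_fin sqr_ge0.
    by rewrite lee_fin sqr_ge0.
  have es a : (\int[mu]_x (g (x + a)%R ^+ 2)%:E = energy g)%E by exact: energy_shift.
  rewrite !es -/(energy g) /K EFinM -muleA; congr (_ * _)%E.
  rewrite [(2 + M ^+ 2)%:E]EFinD ge0_muleDl ?lee_fin ?sqr_ge0 //; congr (_ + _)%E.
  by rewrite -mule2n mule_natl.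
apply: ge0_le_integral => //.
- by move=> x _; rewrite lee_fin sqr_ge0.
- by apply: measurable_sqr; exact: measurable_line_harper.
- by apply: measurable_funeM.
move=> x _; rewrite -EFinM lee_fin /line_harper.
have : (w x * g x) ^+ 2 <= M ^+ 2 * g x ^+ 2.
  rewrite exprMn; apply: ler_wpM2r; first exact: sqr_ge0.
  by rewrite -[w x ^+ 2]real_normK ?num_real // ler_pXn2r ?nnegrE // (le_trans _ (wM 0)).
set a := g (x + h); set b := g (x - h); set c := w x * g x.
have := sqr_ge0 (a - b); have := sqr_ge0 (a - c); have := sqr_ge0 (b - c); lra.
Qed.

(** Cauchy-Schwarz with geometric weights. As the energy of B ^+ k g decays like
    r ^+ (2 * k), the weights r ^- k still leave a convergent sum. *)
Lemma weighted_sum_sqr (r : R) (n : nat) (a : nat -> R) : 0 < r < 1 ->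
  (\sum_(k < n) a k) ^+ 2 <= (1 - r)^-1 * \sum_(k < n) (r ^+ k)^-1 * a k ^+ 2.
Proof.
move=> /andP[r0 r1]; elim: n a => [|n IH] a.
  by rewrite !big_ord0 mulr0 expr0n.
rewrite !big_ord_recl /= expr0 invr1 mul1r.
have s0 : 0 < 1 - r by rewrite subr_gt0.
set T := \sum_(i < n) _; set U := \sum_(i < n) _.
have TU : T ^+ 2 <= (1 - r)^-1 * (r * U).
  apply: le_trans (IH (fun k => a k.+1)) _; rewrite ler_pM2l ?invr_gt0 //.
  rewrite /U mulr_sumr; apply: ler_sum => i _; rewrite /bump /= add1n.
  by rewrite [r ^+ _.+1]exprS invfM !mulrA divff ?mul1r ?gt_eqF.
have -> : (1 - r)^-1 * (a 0%N ^+ 2 + U) =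
   a 0%N ^+ 2 / (1 - r) + ((1 - r)^-1 * (r * U)) / r.
  by field; rewrite !gt_eqF.
apply: (@le_trans _ _ (a 0%N ^+ 2 / (1 - r) + T ^+ 2 / r)); last first.
  by rewrite lerD2l ler_pM2r ?invr_gt0.
rewrite -subr_ge0.
have -> : a 0%N ^+ 2 / (1 - r) + T ^+ 2 / r - (a 0%N + T) ^+ 2 =
   (r * a 0%N - (1 - r) * T) ^+ 2 / (r * (1 - r)).
  by field; rewrite !gt_eqF.
by rewrite divr_ge0 ?sqr_ge0 // mulr_ge0 // ltW.
Qed.

Lemma line_dampD u v x : line_damp (fun y => u y + v y) x = line_damp u x + line_damp v x.
Proof. by rewrite /line_damp /line_harper; ring. Qed.

Let r := Num.sqrt q.

Let r2 : r ^+ 2 = q. Proof. by rewrite sqr_sqrtr // ltW. Qed.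
Let r01 : 0 < r < 1.
Proof. by rewrite sqrtr_gt0 q_gt0 /r -[ltRHS]sqrtr1 ltr_sqrt. Qed.

Section Neumann.
Variable g : R -> R.
Hypothesis mg : measurable_fun setT g.
Hypothesis fg : (energy g < +oo)%E.

Let b k := iter k line_damp g.
Let s n x := \sum_(k < n) b k x.
Let G x : \bar R := (\sum_(0 <= k <oo) ((r ^+ k)^-1 * b k x ^+ 2)%:E)%E.
(* Where G is finite the series converges absolutely; the upper limit is a
   measurable choice of its sum everywhere. *)
Let S x := fine (limn_esup (fun n => (s n x)%:E)).

Let mb k : measurable_fun setT (b k).
Proof. by elim: k => [|k IH] //; exact: measurable_line_damp. Qed.

Let energy_b k : (energy (b k) <= (q ^+ k)%:E * energy g)%E.
Proof.
elim: k => [|k IH]; first by rewrite expr0 mul1e.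
have fin : (energy (b k) < +oo)%E.
  apply: le_lt_trans IH _; rewrite lte_mul_pinfty ?lee_fin ?exprn_ge0 ?(ltW q_gt0) //.
apply: le_trans (energy_line_damp (mb k) fin) _.
by rewrite exprS EFinM -muleA lee_pmul2l ?fin_numE // lte_fin.
Qed.

Let t0 k x : (0 <= ((r ^+ k)^-1 * b k x ^+ 2)%:E)%E.
Proof.
by case/andP: r01 => r0 _; rewrite lee_fin mulr_ge0 ?sqr_ge0 // invr_ge0 exprn_ge0 // ltW.
Qed.

Let mt k : measurable_fun setT (fun x : R => ((r ^+ k)^-1 * b k x ^+ 2)%:E).
Proof.
apply/measurable_EFinP; apply: measurable_funM => //.
by apply: measurable_funX; exact: mb.
Qed.

Let G0 x : (0 <= G x)%E. Proof. by apply: nneseries_ge0 => k _ _; exact: t0. Qed.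

Let mG : measurable_fun setT G.
Proof. by apply: ge0_emeasurable_sum => [k x _ _|k _]; [exact: t0 | exact: mt]. Qed.

Let int_G : (\int[mu]_x G x <= (1 - r)^-1%:E * energy g)%E.
Proof.
have [r0 r1] := andP r01.
have fgn : energy g \is a fin_num by rewrite ge0_fin_numE ?energy_ge0.
rewrite -(fineK fgn); set I := fine (energy g).
have I0 : 0 <= I by rewrite fine_ge0 // energy_ge0.
rewrite /G (integral_nneseries mu measurableT mt (fun k x _ => t0 k x)).
apply: lime_le.
  by apply: is_cvg_nneseries => k _ _; apply: integral_ge0 => x _; exact: t0.
apply: nearW => n.
apply: (@le_trans _ _ (\sum_(0 <= k < n) (r ^+ k * I)%:E)%E).
  apply: lee_sum => k _.
  under eq_integral => x _ do rewrite EFinM.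
  rewrite (ge0_integralZl mu measurableT (measurable_sqr (mb k))); last 2 first.
    by move=> x _; rewrite lee_fin sqr_ge0.
    by rewrite lee_fin invr_ge0 exprn_ge0 // ltW.
  have := energy_b k; rewrite -(fineK fgn) -/I -EFinM => H.
  apply: (@le_trans _ _ ((r ^+ k)^-1%:E * (q ^+ k * I)%:E)%E).
    by rewrite lee_pmul2l ?fin_numE // lte_fin invr_gt0 exprn_gt0.
  have qk : q ^+ k = r ^+ k * r ^+ k by rewrite -r2 -exprM mulnC exprM expr2.
  by rewrite -EFinM lee_fin qk -mulrA mulKf // expf_neq0 // gt_eqF.
rewrite sumEFin -EFinM lee_fin -mulr_suml; apply: ler_wpM2r => //.
have -> : \sum_(0 <= k < n) r ^+ k = (1 - r ^+ n) / (1 - r).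
  have -> : 1 - r ^+ n = (1 - r) * \sum_(i < n) r ^+ i.
    by rewrite -opprB subrX1 -mulNr opprB.
  by rewrite mulrC mulKf ?big_mkord // subr_eq0 gt_eqF.
rewrite -[leRHS]mul1r ler_pM2r ?invr_gt0 ?subr_gt0 //.
by rewrite lerBlDr lerDl exprn_ge0 // ltW.
Qed.

Let partial_G n x : ((\sum_(k < n) (r ^+ k)^-1 * b k x ^+ 2)%:E <= G x)%E.
Proof.
rewrite -sumEFin -(big_mkord xpredT (fun k => ((r ^+ k)^-1 * b k x ^+ 2)%:E)).
by apply: nneseries_lim_ge => k _ _; exact: t0.
Qed.

Let cvg_s x : (G x < +oo)%E -> s n x @[n --> \oo] --> S x.
Proof.
move=> Gx; have [r0 r1] := andP r01.
have Gn : G x \is a fin_num by rewrite ge0_fin_numE.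
have cs : cvgn (fun n => s n x).
  apply: (@geometric_cvg _ _ (Num.sqrt (fine (G x))) (Num.sqrt r)).
    by rewrite sqrtr_ge0 -[ltRHS]sqrtr1 ltr_sqrt.
  move=> n; rewrite /s big_ord_recr /= addrAC subrr add0r.
  rewrite -(ler_pXn2r (n:=2)) ?nnegrE ?mulr_ge0 ?exprn_ge0 ?sqrtr_ge0 //.
  rewrite real_normK ?num_real // exprMn sqr_sqrtr ?fine_ge0 // exprAC sqr_sqrtr ?(ltW r0) //.
  rewrite -ler_pdivrMr ?exprn_gt0 // mulrC -lee_fin fineK //.
  apply: le_trans (partial_G n.+1 x); rewrite lee_fin big_ord_recr /= lerDr.
  by apply: sumr_ge0 => k _; have := t0 k x; rewrite lee_fin.
have cE : (s n x)%:E @[n --> \oo] --> (limn (fun n => s n x))%:E.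
  by apply: cvg_EFin => //; apply: nearW.
by rewrite /S (cvg_limn_einf_sup cE).2.
Qed.

Let mS : measurable_fun setT S.
Proof.
apply: (measurableT_comp (fine_measurable measurableT)).
apply: measurable_fun_limn_esup => n; apply/measurable_EFinP.
by apply: measurable_sum => k; exact: mb.
Qed.

Let sqr_S x : ((S x ^+ 2)%:E <= (1 - r)^-1%:E * G x)%E.
Proof.
have [r0 r1] := andP r01.
have c0 : 0 < (1 - r)^-1 by rewrite invr_gt0 subr_gt0.
have [Gx|] := ltP (G x) +oo%E; last first.
  by rewrite leye_eq => /eqP ->; rewrite gt0_muley ?lte_fin // leey.
have Gn : G x \is a fin_num by rewrite ge0_fin_numE.
have l2 : s n x ^+ 2 @[n --> \oo] --> S x ^+ 2.
  by rewrite expr2; under eq_fun do rewrite expr2; apply: cvgM; exact: cvg_s.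
rewrite -(fineK Gn) -EFinM lee_fin.
apply: (ler_cvg_to l2 (@cvg_cst _ _ _ _ _)); apply: nearW => n.
apply: le_trans (weighted_sum_sqr n (fun k => b k x) r01) _.
by rewrite ler_pM2l // -lee_fin fineK //; exact: partial_G.
Qed.

Let energy_S : (energy S <= ((1 - r)^-1 ^+ 2)%:E * energy g)%E.
Proof.
have [r0 r1] := andP r01.
have c0 : 0 < (1 - r)^-1 by rewrite invr_gt0 subr_gt0.
rewrite expr2 EFinM -muleA.
apply: (@le_trans _ _ ((1 - r)^-1%:E * \int[mu]_x G x)%E); last first.
  by rewrite lee_pmul2l ?fin_numE // lte_fin.
rewrite -(ge0_integralZl mu measurableT mG (fun x _ => G0 x)) ?lee_fin ?(ltW c0) //.
apply: ge0_le_integral => //.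
- by move=> x _; rewrite lee_fin sqr_ge0.
- exact: measurable_sqr.
- by apply: measurable_funeM.
Qed.

Let ae_G a : {ae mu, forall x, (G (x + a) < +oo)%E}.
Proof.
have mGa : measurable_fun setT (fun x : R => G (x + a)).
  by apply: (measurableT_comp mG); exact: measurable_shift.
have iG : mu.-integrable setT (fun x : R => G (x + a)).
  apply/integrableP; split=> //.
  under eq_integral => x _ do rewrite gee0_abs ?G0 //.
  rewrite (ge0_integral_shift a mG G0); apply: le_lt_trans int_G _.
  have [r0 r1] := andP r01.
  by rewrite lte_mul_pinfty // ?lee_fin // invr_ge0 subr_ge0 ltW.
have := integrable_ae measurableT iG; apply: aeS => x /(_ I).
by rewrite ge0_fin_numE.
Qed.

Let line_damp_s n x : line_damp (s n) x = s n.+1 x - g x.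
Proof.
elim: n => [|n IH].
  rewrite /s big_ord_recl !big_ord0 addr0 /= subrr.
  by rewrite /line_damp /line_harper /s !big_ord0; ring.
have -> : s n.+1 = (fun y => s n y + b n y).
  by apply/funext => y; rewrite /s big_ord_recr.
by rewrite line_dampD IH /s [in RHS]big_ord_recr /=; ring.
Qed.

(** K^-1 A (1 + B + B^2 + ...) inverts A, since A ^+ 2 = K (1 - B). *)
Lemma neumann_solution : exists f : R -> R, [/\ measurable_fun setT f,
  (energy f <= (K^-1 * (1 - r)^-1 ^+ 2)%:E * energy g)%E &
  {ae mu, forall x, line_harper f x = g x}].
Proof.
exists (fun x => K^-1 * line_harper S x); split.
- by apply: measurable_funM => //; exact: measurable_line_harper.
- have -> : energy (fun x => K^-1 * line_harper S x) = ((K^-1 ^+ 2)%:E * energy (line_harper S))%E.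
    rewrite /energy -(ge0_integralZl mu measurableT); last 3 first.
      by apply: measurable_sqr; exact: measurable_line_harper.
      by move=> x _; rewrite lee_fin sqr_ge0.
      by rewrite lee_fin sqr_ge0.
    by apply: eq_integral => x _; rewrite exprMn EFinM.
  apply: (@le_trans _ _ ((K^-1 ^+ 2)%:E * (K%:E * energy S))%E).
    by rewrite lee_pmul2l ?fin_numE ?lte_fin ?exprn_gt0 ?invr_gt0 //; exact: energy_line_harper.
  rewrite muleA -EFinM expr2 -mulrA mulVf ?gt_eqF // mulr1 EFinM -muleA.
  by rewrite lee_pmul2l ?fin_numE ?lte_fin ?invr_gt0.
have := aeI (aeI (aeI (ae_G (h + h)) (ae_G h)) (aeI (ae_G (- h)) (ae_G (- h - h)))) (ae_G 0).
apply: aeS => x [[[G2 G1] [G_1 G_2]] G0'].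
have [s2 s1] := (cvg_s G2, cvg_s G1); have [s_1 s_2] := (cvg_s G_1, cvg_s G_2).
have s0 := cvg_s G0'; rewrite addr0 in s0.
have line_harper_cvg y : s n (y + h) @[n --> \oo] --> S (y + h) ->
    s n (y - h) @[n --> \oo] --> S (y - h) -> s n y @[n --> \oo] --> S y ->
    line_harper (s n) y @[n --> \oo] --> line_harper S y.
  move=> c1 c2 c3; apply: cvgD; first exact: cvgD.
  by apply: cvgM => //; exact: cvg_cst.
have c1 : line_harper (s n) (x + h) @[n --> \oo] --> line_harper S (x + h).
  by apply: line_harper_cvg; rewrite ?addrK // -addrA.
have c_1 : line_harper (s n) (x - h) @[n --> \oo] --> line_harper S (x - h).
  by apply: line_harper_cvg; rewrite ?subrK // -addrA.
have c0 : line_harper (s n) x @[n --> \oo] --> line_harper S x by exact: line_harper_cvg.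
have cb : line_damp (s n) x @[n --> \oo] --> line_damp S x.
  apply: cvgB => //; apply: cvgM; first exact: cvg_cst.
  by apply: cvgD; [exact: cvgD | apply: cvgM => //; exact: cvg_cst].
have cb2 : line_damp (s n) x @[n --> \oo] --> S x - g x.
  under eq_fun do rewrite line_damp_s.
  by apply: cvgB; [rewrite (cvg_shiftS (fun n => s n x)) | exact: cvg_cst].
have E : line_damp S x = S x - g x by exact: (cvg_unique _ cb cb2).
have -> : line_harper (fun y => K^-1 * line_harper S y) x = S x - line_damp S x by rewrite /line_damp /line_harper; ring.
by rewrite E opprB addrC subrK.
Qed.
End Neumann.

Lemma energy_eq0 (u : R -> R) : measurable_fun setT u -> energy u = 0%E ->
  {ae mu, forall x, u x = 0}.
Proof.
move=> mU e0.
have : ae_eq mu setT (fun x => (u x ^+ 2)%:E) (cst 0%E).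
  apply/(ae_eq_integral_abs mu measurableT (measurable_sqr mU)).
  by rewrite -[RHS]e0; apply: eq_integral => x _; rewrite gee0_abs // lee_fin sqr_ge0.
apply: aeS => x /(_ I) [] /eqP; rewrite sqrf_eq0 => /eqP; exact.
Qed.

Lemma ae0_energy (u : R -> R) : measurable_fun setT u -> {ae mu, forall x, u x = 0} ->
  energy u = 0%E.
Proof.
move=> mU u0; rewrite /energy -[RHS](@integral0 _ _ _ mu setT).
apply: ae_eq_integral => //; first exact: measurable_sqr.
by move: u0; apply: aeS => x + _; move=> ->; rewrite expr0n.
Qed.

(** If A u = 0 then B u = u, and B is a strict contraction. *)
Lemma line_harper_injective (u : R -> R) : measurable_fun setT u -> (energy u < +oo)%E ->
  {ae mu, forall x, line_harper u x = 0} -> {ae mu, forall x, u x = 0}.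
Proof.
move=> mU fu u0; have [r0 r1] := andP r01.
have m1 := measurable_line_harper mU; have m2 := measurable_line_harper m1.
have e1 := ae0_energy m1 u0.
have e2 : energy (line_harper (line_harper u)) = 0%E.
  apply/eqP; rewrite eq_le energy_ge0 andbT.
  by apply: le_trans (energy_line_harper m1) _; rewrite e1 mule0.
have u2 := energy_eq0 m2 e2.
have eb : energy u = energy (line_damp u).
  apply: ae_eq_integral => //; [exact: measurable_sqr | |].
    by apply: measurable_sqr; exact: measurable_line_damp.
  by move: u2; apply: aeS => x e _; rewrite /line_damp e mulr0 subr0.
apply: energy_eq0 => //.
have := energy_line_damp mU fu; rewrite -eb.
have fn : energy u \is a fin_num by rewrite ge0_fin_numE ?energy_ge0.
rewrite -(fineK fn) -EFinM lee_fin => H; congr EFin.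
have I0 : 0 <= fine (energy u) by rewrite fine_ge0 // energy_ge0.
apply/eqP; rewrite eq_le I0 andbT leNgt; apply/negP => Ip.
by move: H; rewrite leNgt gtr_pMl // q_lt1.
Qed.

End Solve.
End SquareIntegrable.

(** * The resolvent set of the Harper operator *)

Section Resolvent.
Variable R : realType.
Local Notation C := R[i].
Local Notation Re := (@complex.Re R).
Local Notation Im := (@complex.Im R).
Local Notation mu := (@lebesgue_measure R).

Lemma sqr_Re_norm (z : C) : Re `|z| ^+ 2 = sqn z.
Proof. by rewrite normc_def /= sqr_sqrtr ?addr_ge0 ?sqr_ge0. Qed.

Lemma normL2E (f : R -> C) :
  measurable_fun setT (fun x => Re (f x)) -> measurable_fun setT (fun x => Im (f x)) ->
  normL2 f = ((energy (fun x => Re (f x)) + energy (fun x => Im (f x))) `^ 2^-1)%E.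
Proof.
move=> mr mi; rewrite /normL2 unlock; congr (_ `^ _)%E.
have p (u : R -> R) x : (0 <= (u x ^+ 2)%:E)%E by rewrite lee_fin sqr_ge0.
rewrite -(ge0_integralD mu measurableT (fun x _ => p _ x) (measurable_sqr mr)
  (fun x _ => p _ x) (measurable_sqr mi)).
apply: eq_integral => x _ /=.
rewrite powR_mulrn // real_normK ?num_real //.
by rewrite -[Normc.normc _]/(Re `|f x|) sqr_Re_norm.
Qed.

Lemma inL2P (f : R -> C) : inL2 f <->
  [/\ measurable_fun setT (fun x => Re (f x)), measurable_fun setT (fun x => Im (f x)),
      (energy (fun x => Re (f x)) < +oo)%E & (energy (fun x => Im (f x)) < +oo)%E].
Proof.
split=> [[mr mi]|[mr mi er ei]]; last first.
  by split=> //; rewrite normL2E // poweR_lty // lte_add_pinfty.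
rewrite normL2E // => /lty_poweRy; rewrite invr_eq0 pnatr_eq0 => /(_ isT) H.
split=> //; apply: le_lt_trans H; first by rewrite leeDl // energy_ge0.
by rewrite leeDr // energy_ge0.
Qed.

Variables (lambda h E : R).
Let w x := 2 * lambda * cos (2 * pi * x) - E.
Let M := `|2 * lambda| + `|E|.

Lemma harper_potential_bound x : `|w x| <= M.
Proof.
rewrite /w; apply: le_trans (ler_normB _ _) _; rewrite lerD2r normrM.
by rewrite ler_piMr // cos_max.
Qed.

Lemma measurable_harper_potential : measurable_fun setT w.
Proof.
apply: measurable_funB => //; apply: measurable_funM => //.
apply: (measurableT_comp (f := cos)); first exact: continuous_measurable_fun (@continuous_cos R).
exact: measurable_funM.
Qed.

Lemma harper_opE (f : R -> C) (g : C) x :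
  harper_op lambda h f x - E%:C * f x = g <->
  line_harper w h (fun y => Re (f y)) x = Re g /\ line_harper w h (fun y => Im (f y)) x = Im g.
Proof.
rewrite /harper_op /line_harper /w; case: g => g1 g2 /=.
case: (f (x + h)) => a1 a2; case: (f (x - h)) => b1 b2; case: (f x) => c1 c2 /=.
split=> [[<- <-]|[<- <-]]; first by split; ring.
by apply/eqP; rewrite eq_complex /=; apply/andP; split; apply/eqP; ring.
Qed.

(** A lower bound on the fibres gives a bounded inverse on L^2; the real and
    imaginary parts are inverted separately since H - E is real. *)
Lemma fibre_bound_resolvent (d : R) : 0 < d ->
  (forall x u, d * ip u u <= ip (fharper (fun n => w (x + n%:~R * h)) u)
                               (fharper (fun n => w (x + n%:~R * h)) u)) ->
  resolvent_set (harper_op lambda h) E%:C.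
Proof.
move=> d0 low; set K := 3 * (2 + M ^+ 2).
have K0 : 0 < K by rewrite mulr_gt0 // ltr_wpDr ?sqr_ge0.
set d' := Num.min d (K / 2).
have d'K : 0 < d' <= K / 2 by rewrite lt_min d0 divr_gt0 //= ge_min lexx orbT.
have low' x u : d' * ip u u <= ip (fharper (fun n => w (x + n%:~R * h)) u)
                               (fharper (fun n => w (x + n%:~R * h)) u).
  by apply: le_trans (low x u); apply: ler_wpM2r; rewrite ?ip_ge0 // ge_min lexx.
have mw := measurable_harper_potential; have wM := harper_potential_bound.
set B := K^-1 * (1 - Num.sqrt (1 - d' / K))^-1 ^+ 2.
have B0 : 0 <= B by rewrite mulr_ge0 ?sqr_ge0 // invr_ge0 ltW.
exists (B `^ 2^-1) => g /inL2P[mgr mgi egr egi].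
have [fr [mfr efr hfr]] := neumann_solution mw wM d'K low' mgr egr.
have [fi [mfi efi hfi]] := neumann_solution mw wM d'K low' mgi egi.
have fin u v : (energy u < +oo)%E -> (energy v <= B%:E * energy u)%E -> (energy v < +oo)%E.
  by move=> eu /le_lt_trans; apply; rewrite lte_mul_pinfty ?lee_fin.
exists (fun x => fr x +i* fi x); split.
- by apply/inL2P; split=> //; [exact: fin efr | exact: fin efi].
- apply: aeS (aeI hfr hfi) => x [e1 e2].
  by apply/harper_opE.
- have en0 (u v : R -> R) : (0 <= energy u + energy v)%E.
    by apply: adde_ge0; exact: energy_ge0.
  rewrite !normL2E // -poweR_EFin -poweRM ?lee_fin ?en0 //.
  apply: gt0_ler_poweR; rewrite ?invr_ge0 ?ler0n //.
  + by rewrite in_itv /= leey andbT en0.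
  + by rewrite in_itv /= leey andbT; apply: mule_ge0; rewrite ?lee_fin ?en0.
  + by rewrite (ge0_muleDr _ (energy_ge0 _) (energy_ge0 _)); exact: leeD.
move=> f' /inL2P[mr mi er ei] eq.
have diff (u v t : R -> R) : measurable_fun setT u -> measurable_fun setT v ->
    (energy u < +oo)%E -> (energy v < +oo)%E ->
    {ae mu, forall x, line_harper w h u x = t x} -> {ae mu, forall x, line_harper w h v x = t x} ->
    {ae mu, forall x, u x = v x}.
  move=> mu_ mv eu ev hu hv.
  have mD : measurable_fun setT (fun x => u x - v x) by exact: measurable_funB.
  have eD : (energy (fun x => u x - v x)%R < +oo)%E.
    have fu2 : (2%:E * energy u + 2%:E * energy v < +oo)%E.
      by rewrite lte_add_pinfty // lte_mul_pinfty.
    apply: le_lt_trans fu2.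
    have p (z : R -> R) x : (0 <= (z x ^+ 2)%:E)%E by rewrite lee_fin sqr_ge0.
    rewrite /energy.
    rewrite -(ge0_integralZl mu measurableT (measurable_sqr mu_) (fun x _ => p u x)) //.
    rewrite -(ge0_integralZl mu measurableT (measurable_sqr mv) (fun x _ => p v x)) //.
    have mz (z : R -> R) : measurable_fun setT z ->
        measurable_fun setT (fun x => 2%:E * (z x ^+ 2)%:E)%E.
      by move=> mz; apply: measurable_funeM; exact: measurable_sqr.
    have pz (z : R -> R) x : (0 <= 2%:E * (z x ^+ 2)%:E)%E by rewrite mule_ge0.
    rewrite -(ge0_integralD mu measurableT (fun x _ => pz u x) (mz u mu_)
       (fun x _ => pz v x) (mz v mv)).
    apply: ge0_le_integral => //.
    - exact: measurable_sqr.
    - by apply: emeasurable_funD; exact: mz.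
    move=> x _; rewrite -!EFinM -EFinD lee_fin.
    by have := sqr_ge0 (u x + v x); lra.
  have := line_harper_injective mw wM d'K low' mD eD.
  move=> H; apply: aeS (H _) => [x /eqP|]; first by rewrite subr_eq0 => /eqP.
  apply: aeS (aeI hu hv) => x [e1 e2].
  transitivity (line_harper w h u x - line_harper w h v x); first by rewrite /line_harper; ring.
  by rewrite e1 e2 subrr.
have eqr : {ae mu, forall x, line_harper w h (fun y => Re (f' y)) x = Re (g x)}.
  by apply: aeS eq => x /harper_opE[].
have eqi : {ae mu, forall x, line_harper w h (fun y => Im (f' y)) x = Im (g x)}.
  by apply: aeS eq => x /harper_opE[].
have D1 := diff _ _ _ mr mfr er (fin _ _ egr efr) eqr hfr.
have D2 := diff _ _ _ mi mfi ei (fin _ _ egi efi) eqi hfi.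
apply: aeS (aeI D1 D2) => x [].
by case: (f' x) => a b /= -> ->.
Qed.

End Resolvent.

(** * The lower bound at regular energies *)

Section RegularEnergy.
Variable R : realType.
Local Notation C := R[i].
Local Notation Re := (@complex.Re R).
Local Notation Im := (@complex.Im R).
Local Notation "'i" := (@Complex R 0 1).

Lemma cexp_imaginary (y : R) : cexp ('i * y%:C) = cos y +i* sin y.
Proof.
have -> : 'i * y%:C = 0 +i* y.
  by apply/eqP; rewrite eq_complex /=; apply/andP; split; apply/eqP; ring.
by rewrite /cexp /= expR0 -[1%:C]/(1 : C) mul1r.
Qed.

Lemma cexpN_imaginary (y : R) : cexp (- ('i * y%:C)) = (cos y +i* sin y)^*.
Proof.
have -> : - ('i * y%:C) = 'i * (- y)%:C by rewrite rmorphN mulrN.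
by rewrite cexp_imaginary cosN sinN.
Qed.

Lemma ccos_real (y : R) : ccos y%:C = (cos y)%:C.
Proof.
rewrite /ccos cexp_imaginary cexpN_imaginary.
have -> : (cos y +i* sin y) + (cos y +i* sin y)^* = (cos y)%:C * 2.
  by apply/eqP; rewrite eq_complex /=; apply/andP; split; apply/eqP; ring.
by rewrite mulfK // pnatr_eq0.
Qed.

Lemma cos_periodic_int (y : R) (k : int) : cos (2 * pi * (y + k%:~R)) = cos (2 * pi * y).
Proof.
have step (z : R) : cos (2 * pi * (z + 1)) = cos (2 * pi * z).
  by rewrite mulrDr mulr1 [2 * pi]mulrC mulr_natr cosD2pi.
have pn (n : nat) (z : R) : cos (2 * pi * (z + n%:R)) = cos (2 * pi * z).
  by elim: n => [|n IH]; [rewrite mulr0n addr0 | rewrite -[n.+1%:R]natr1 addrA step].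
case: k => n; first by rewrite -pmulrn pn.
by rewrite NegzE -(pn n.+1) mulrNz -pmulrn subrK.
Qed.

Lemma holomorphic_continuous (psi : C -> C) z : holomorphic_at psi z ->
  {for z, continuous (psi : C^o -> C^o)}.
Proof. by move=> /derivable1_diffP /differentiable_continuous. Qed.

Lemma norm_real (x : R) : `|x%:C| = `|x|%:C :> C.
Proof. by rewrite normc_def /= expr0n addr0 sqrtr_sqr. Qed.

Lemma norm_ReE (z : C) : `|z| = (Re `|z|)%:C.
Proof. by rewrite normc_def. Qed.

Lemma dist_Re_norm (a b : C) : `|Re `|a| - Re `|b| | <= Re `|a - b|.
Proof.
have := ler_dist_dist a b.
by rewrite (norm_ReE a) (norm_ReE b) (norm_ReE (a - b)) -rmorphB norm_real lecR.
Qed.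

Lemma gt0_real (d : C) : 0 < d -> d = (Re d)%:C /\ 0 < Re d.
Proof. by case: d => a b; rewrite ltcE /= => /andP[/eqP -> a0]. Qed.

Lemma continuous_sqn_bounded (psi : C -> C) (a b : R) : a <= b ->
  holomorphic_on setT psi ->
  exists2 B : R, 0 < B & forall x, a <= x <= b -> sqn (psi x%:C) <= B.
Proof.
move=> ab hol.
pose f (x : R) := Re `|psi x%:C|.
have cf : continuous f.
  move=> x; apply/cvgrPdist_lt => e e0.
  have e0C : 0 < e%:C :> C by rewrite ltcR.
  have /cvgrPdist_lt /(_ _ e0C) := holomorphic_continuous (hol x%:C I).
  move=> /nbhs_ballP[d /= /gt0_real[dE d0] H].
  apply/nbhs_ballP; exists (Re d) => //= y xy.
  have /H : ball (x%:C : C^o) d y%:C.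
    by rewrite /ball /= -rmorphB norm_real dE ltcR.
  rewrite /= (norm_ReE (_ - _)) ltcR => h1.
  by apply: le_lt_trans h1; exact: dist_Re_norm.
have [c _ cP] := EVT_max ab (@continuous_subspaceT _ _ _ _ cf).
exists (f c ^+ 2 + 1); first by rewrite ltr_wpDl ?sqr_ge0.
move=> x xab; rewrite -sqr_Re_norm -/(f x).
have fx0 z : 0 <= f z by rewrite /f normc_def /= sqrtr_ge0.
have : f x <= f c by apply: cP; rewrite in_itv.
by move=> H; have := fx0 x; nra.
Qed.

(** From sequences indexed by nat, as they come out of the Cauchy problem, to
    finitely supported sequences on the fibre. *)
Lemma fibre_bound_fseq (v : R -> R) (h K : R) : 0 < K ->
  (forall x0 (U : nat -> R) m, U 0%N = 0 -> U 1%N = 0 -> U m = 0 -> U m.+1 = 0 ->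
    \sum_(i < m) U i.+1 ^+ 2 <=
    K * \sum_(i < m) (U i.+2 + U i + v (x0 + i.+1%:R * h) * U i.+1) ^+ 2) ->
  forall x u, K^-1 * ip u u <= ip (fharper (fun n => v (x + n%:~R * h)) u)
                                 (fharper (fun n => v (x + n%:~R * h)) u).
Proof.
move=> K0 H x u; have [N uN] := fseqP u.
rewrite ler_pdivrMl //.
set U := fun i : nat => u (i%:Z - N.+2%:Z).
have z (n : int) : (N < `|n|)%N -> u n = 0 by exact: uN.
have := H (x - N.+2%:R * h) U N.+1.*2.+1.
rewrite /U; do 4! (move=> /(_ ltac:(by apply: z; lia))).
move=> le1; have uN1 : supported N.+1 u by apply: supported_le uN; lia.
rewrite (ip_window _ uN1) /window.
have -> : \sum_(i < N.+1.*2.+1) u (i%:Z - N.+1%:Z) * u (i%:Z - N.+1%:Z) =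
    \sum_(i < N.+1.*2.+1) u (i.+1%:Z - N.+2%:Z) ^+ 2.
  apply: eq_bigr => i _; rewrite expr2.
  by have -> : i.+1%:Z - N.+2%:Z = i%:Z - N.+1%:Z by lia.
apply: le_trans le1 _; apply: ler_wpM2l; first exact: ltW.
apply: le_trans (window_le_ip N.+1 _); rewrite /window.
apply: ler_sum => i _; rewrite le_eqVlt; apply/orP; left; apply/eqP.
rewrite -expr2 fharperE; congr ((u _ + u _ + v _ * u _) ^+ 2); try lia.
have -> : (i%:Z - N.+1%:Z)%:~R = i.+1%:R - N.+2%:R :> R.
  have -> : i%:Z - N.+1%:Z = i.+1%:Z - N.+2%:Z by lia.
  by rewrite intrB -!pmulrn.
by ring.
Qed.

Section AtEnergy.
Variables (lambda h E L : R) (s t W : C) (psi : C -> C).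
Let l1 := lambda1 lambda h.
Let v x := 2 * lambda * cos (2 * pi * x) - E.
Hypothesis h01 : 0 < h < 1.
Hypothesis l1_gt0 : 0 < l1.
Hypotheses (s0 : s != 0) (t0 : t != 0) (W0 : W != 0).
Hypothesis hol : holomorphic_on setT psi.
Hypothesis heq : harper_eq_on lambda h setT E%:C psi.
Hypothesis wr : forall z, wronskian h psi (Defs.reflect psi) z = W.
Hypothesis mon : is_monodromy_matrix h psi (monodromy_form lambda h s t).
Hypothesis LE : coef_a lambda h s t + s * t / l1%:C = L%:C.
Hypothesis L1 : 2 * l1 < `|L|.
Hypothesis L2 : l1 * `|L| < L ^+ 2 / 4 - 1 - Im t ^+ 2.

Let psi1 (x : R) := psi x%:C.
Let psi2 (x : R) := psi (1 - x%:C).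
Let rho := s * t / l1%:C.

Let l1C : l1%:C != 0 :> C.
Proof. by rewrite eq_complex /= eqxx andbT gt_eqF. Qed.

Let harper1 x : psi1 (x + h) + psi1 (x - h) + (v x)%:C * psi1 x = 0.
Proof.
have := heq (z := x%:C) I; rewrite -rmorphM ccos_real /psi1 => H.
rewrite rmorphD rmorphB /= /v rmorphB /= !rmorphM /= mulrBl -H.
by rewrite rmorphM; ring.
Qed.

Let harper2 x : psi2 (x + h) + psi2 (x - h) + (v x)%:C * psi2 x = 0.
Proof.
have := heq (z := 1 - x%:C) I.
have -> : (2 * pi)%:C * (1 - x%:C) = (2 * pi * (1 - x))%:C :> C.
  by rewrite !rmorphM rmorphB rmorph1.
rewrite ccos_real.
have -> : cos (2 * pi * (1 - x)) = cos (2 * pi * x).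
  by rewrite addrC -[1 in LHS]/(1%:~R) cos_periodic_int mulrN cosN.
rewrite /psi2 => H.
have -> : 1 - (x + h)%:C = 1 - x%:C - h%:C :> C by rewrite rmorphD opprD addrA.
have -> : 1 - (x - h)%:C = 1 - x%:C + h%:C :> C by rewrite rmorphB; ring.
rewrite /v rmorphB /= !rmorphM /= mulrBl -H !rmorphM /=; ring.
Qed.

Let wronsk x : psi1 (x + h) * psi2 x - psi1 x * psi2 (x + h) = W.
Proof. by rewrite -(wr x%:C) /wronskian /Defs.reflect /psi1 /psi2 rmorphD. Qed.

Let m00 (x : R) : C := L%:C - rho - (2 * l1 * cos (2 * pi * (x / h)))%:C.
Let ex (x : R) : C := cos (2 * pi * (x / h)) +i* sin (2 * pi * (x / h)).
Let m01 (x : R) : C := s + t * (ex x)^*.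
Let m10 (x : R) : C := - (s + t * ex x).

Let aE : coef_a lambda h s t = L%:C - rho.
Proof. by rewrite -LE addrK. Qed.

Let mono1 x : psi1 (x + 1) = m00 x * psi1 x + m01 x * psi2 x.
Proof.
have := congr1 (fun A : 'cV[C]_2 => A ord0 ord0) (mon x).
rewrite !mxE !big_ord_recl big_ord0 !mxE /= addr0 /psi1 => ->.
by rewrite aE cexpN_imaginary.
Qed.

Let mono2 x : psi2 (x + 1) = m10 x * psi1 x + rho * psi2 x.
Proof.
have := congr1 (fun A : 'cV[C]_2 => A (lift ord0 ord0) ord0) (mon x).
rewrite !mxE !big_ord_recl big_ord0 !mxE /= addr0 /Defs.reflect /psi2 => ->.
by rewrite cexp_imaginary -opprD.
Qed.

Let h_neq0 : h != 0. Proof. by case/andP: h01 => h0 _; rewrite gt_eqF. Qed.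

Let angle_step (x : R) : cos (2 * pi * ((x + h) / h)) = cos (2 * pi * (x / h)) /\
  sin (2 * pi * ((x + h) / h)) = sin (2 * pi * (x / h)).
Proof.
have -> : 2 * pi * ((x + h) / h) = 2 * pi * (x / h) + pi *+ 2.
  have -> : (x + h) / h = x / h + 1 by rewrite mulrDl divff.
  by rewrite mulrDr mulr1 [in X in _ + X]mulrC mulr_natr.
by rewrite cosD2pi sinD2pi.
Qed.

Let mono_per x : [/\ m00 (x + h) = m00 x, m01 (x + h) = m01 x,
  m10 (x + h) = m10 x & rho = rho].
Proof. by have [e1 e2] := angle_step x; rewrite /m00 /m01 /m10 /ex e1 e2. Qed.

Let rho_eq : (L%:C - rho) * rho = 1 - s ^+ 2 - t ^+ 2.
Proof.
rewrite -aE /coef_a /rho -/l1; field.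
by rewrite l1C s0 t0.
Qed.

Let st_eq : s * t = l1%:C * rho.
Proof. by rewrite /rho [RHS]mulrC divfK. Qed.

Let mono_det x : m00 x * rho - m01 x * m10 x = 1.
Proof.
set th := 2 * pi * (x / h).
have e1 : ex x * (ex x)^* = 1.
  apply/eqP; rewrite eq_complex /=; apply/andP; split; apply/eqP; last by ring.
  by rewrite -[RHS](cos2Dsin2 th) /th; ring.
have e2 : ex x + (ex x)^* = (2 * cos th)%:C.
  by apply/eqP; rewrite eq_complex /=; apply/andP; split; apply/eqP; rewrite /th; ring.
transitivity ((L%:C - rho) * rho + s ^+ 2 + t ^+ 2 * (ex x * (ex x)^*) +
    s * t * (ex x + (ex x)^*) - (2 * cos th)%:C * (l1%:C * rho)).
  by rewrite /m00 /m01 /m10 -/th !rmorphM /=; ring.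
by rewrite e1 e2 rho_eq -st_eq; ring.
Qed.

Lemma energy_fibre_bound : exists2 d, 0 < d & forall x u,
  d * ip u u <= ip (fharper (fun n => v (x + n%:~R * h)) u)
                   (fharper (fun n => v (x + n%:~R * h)) u).
Proof.
have [a [b [c c0 lyap]]] := monodromy_lyapunov l1_gt0 st_eq rho_eq L1 L2.
have [B1 B10 b1] := continuous_sqn_bounded (a := 0) (b := 2) ltac:(by []) hol.
have [B2 B20 b2] := continuous_sqn_bounded (a := - 1) (b := 1) ltac:(lra) hol.
have [K K0 KP] : exists2 K, 0 < K & forall x0 (U : nat -> R) m,
  U 0%N = 0 -> U 1%N = 0 -> U m = 0 -> U m.+1 = 0 ->
  \sum_(i < m) U i.+1 ^+ 2 <=
  K * \sum_(i < m) (U i.+2 + U i + v (x0 + i.+1%:R * h) * U i.+1) ^+ 2.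
  apply: (@fibre_bound _ h psi1 psi2 v W m00 m01 m10 (fun=> rho) h01 W0
    harper1 harper2 wronsk _ mono1 mono2 mono_per mono_det (B1 + B2) _ _ _ a b c c0) => //.
  - by move=> x k; rewrite /v cos_periodic_int.
  - by rewrite addr_gt0.
  - by move=> x x02; apply: le_trans (b1 x x02) _; rewrite lerDl ltW.
  - move=> x /andP[x0 x2]; rewrite /psi2 -[1 - x%:C](rmorphB (real_complex R) 1 x).
    by apply: le_trans (b2 (1 - x) _) _; [apply/andP; split; lra | rewrite lerDr ltW].
  - move=> x p q; have := lyap (2 * pi * (x / h)) p q.
    by rewrite /m00 /m01 /m10 mulrN.
exists K^-1; first by rewrite invr_gt0.
exact: fibre_bound_fseq KP.
Qed.

End AtEnergy.
End RegularEnergy.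

(** * Coefficients meromorphic in the energy *)

Section Meromorphic.
Variable R : realType.
Local Notation C := R[i].
Local Notation Re := (@complex.Re R).
Local Notation Im := (@complex.Im R).

Definition continuousC_at (f : C -> C) (z : C) :=
  (f : C^o -> C^o) w @[w --> (z : C^o)] --> (f z : C^o).

Lemma continuousC_atM f g z : continuousC_at f z -> continuousC_at g z ->
  continuousC_at (fun w => f w * g w) z.
Proof. exact: (@cvgM C _ _ (nbhs_filter (z : C^o))). Qed.

Lemma continuousC_at_cst a z : continuousC_at (fun=> a) z.
Proof. exact: (@cvg_cst _ (a : C^o) _ _ (nbhs_filter (z : C^o))). Qed.

Lemma continuousC_atD f g z : continuousC_at f z -> continuousC_at g z ->
  continuousC_at (fun w => f w + g w) z.
Proof. exact: (@cvgD C C^o _ _ (nbhs_filter (z : C^o))). Qed.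

Lemma continuousC_atN f z : continuousC_at f z -> continuousC_at (fun w => - f w) z.
Proof. exact: (@cvgN C C^o _ _ (nbhs_filter (z : C^o))). Qed.

Lemma continuousC_atV f z : f z != 0 -> continuousC_at f z ->
  continuousC_at (fun w => (f w)^-1) z.
Proof. exact: (@cvgV C _ _ (nbhs_filter (z : C^o))). Qed.

Lemma continuousC_atX f n z : continuousC_at f z -> continuousC_at (fun w => f w ^+ n) z.
Proof.
move=> cf; elim: n => [|n IH]; first exact: continuousC_at_cst.
have -> : (fun w => f w ^+ n.+1) = (fun w => f w * f w ^+ n).
  by apply/funext => w; rewrite exprS.
exact: continuousC_atM.
Qed.

Lemma near_neq (w p : C) : w != p -> \forall u \near (w : C^o), u != p.
Proof.
move=> wp; apply/nbhs_ballP; exists `|w - p|; first by rewrite /= normr_gt0 subr_eq0.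
by move=> u /=; rewrite /ball /=; apply: contraTneq => ->; rewrite ltxx.
Qed.

(** A punctured neighbourhood of p is a neighbourhood of each of its points. *)
Lemma near_dnbhs_near (P : C -> Prop) (p : C) :
  (\forall w \near (p : C^o)^', P w) ->
  \forall w \near (p : C^o)^', \forall u \near (w : C^o), P u.
Proof.
rewrite near_withinE => /nbhs_interior Pint.
rewrite near_withinE; apply: filterS Pint => w /= Pw /near_neq neqw.
by apply: filterS2 Pw neqw => u; exact.
Qed.

Lemma meromorphic_continuous f : meromorphic f ->
  generically (continuousC_at f).
Proof.
move=> mf p; have [n [g [hg fg]]] := mf p.
have := near_dnbhs_near fg; have := nbhs_dnbhs hg; have := nbhs_dnbhs_neq (p : C^o).
apply: filterS3 => w wp hw fw.
have cw : continuousC_at (fun u => g u * ((u - p) ^+ n)^-1) w.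
  apply: continuousC_atM; first exact: holomorphic_continuous.
  apply: continuousC_atV; first by rewrite expf_neq0 // subr_eq0.
  apply: continuousC_atX; apply: continuousC_atD; last exact: continuousC_at_cst.
  exact: cvg_id.
have eqw : \forall u \near (w : C^o), g u * ((u - p) ^+ n)^-1 = f u.
  apply: filterS2 (near_neq wp) fw => u up <-.
  by rewrite mulrAC divff ?mul1r // expf_neq0 // subr_eq0.
rewrite /continuousC_at -(nbhs_singleton eqw).
apply: cvg_trans cw.
exact: (@near_eq_cvg _ _ _ (nbhs_filter (w : C^o)) _ _ eqw).
Qed.

Lemma generically_real (P : C -> Prop) (E0 : R) : generically P ->
  exists2 eps, 0 < eps & forall E, 0 < `|E - E0| < eps -> P E%:C.
Proof.
move=> /(_ E0%:C) /nbhs_ballP[d /= /gt0_real[dE d0] H].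
exists (Re d) => // E /andP[E0' Ed]; apply: H.
  by rewrite /ball /= -rmorphB norm_real dE ltcR distrC.
by apply: contraTneq E0' => -[->]; rewrite subrr normr0 ltxx.
Qed.

Lemma mero_value_unique f z v : continuousC_at f z -> mero_value f z v -> v = f z.
Proof.
move=> cf fv; have /(@continuous_withinNx C^o C^o) cf' := cf.
have PF : ProperFilter (dnbhs (z : C^o)) by exact: Proper_dnbhs_regular_numFieldType.
exact: (@cvg_unique C^o (@norm_hausdorff _ C^o) _ _ _ _ fv cf').
Qed.

End Meromorphic.

Section TraceCoefficient.
Variable R : realType.
Local Notation C := R[i].
Local Notation Re := (@complex.Re R).
Local Notation Im := (@complex.Im R).
Local Notation mu := (@lebesgue_measure R).

Lemma integral_trigonometric (c k : R) :
  \int[mu]_(x in `[0, 1]) (c - k * cos (2 * pi * x)) = c.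
Proof.
rewrite /Rintegral.
set F := fun x : R => c * x - k * (sin (2 * pi * x) / (2 * pi)).
have pi2 : 2 * pi != 0 :> R by rewrite mulf_neq0 // gt_eqF // pi_gt0.
have dF (x : R) : is_derive x 1 F (c - k * cos (2 * pi * x)).
  rewrite /F.
  have d1 : is_derive x 1 (fun x : R => 2 * pi * x) (2 * pi).
    by apply: is_derive_eq; rewrite /GRing.scale /= mulr1.
  have d2 : is_derive x 1 (fun x : R => sin (2 * pi * x)) (2 * pi * cos (2 * pi * x)).
    by apply: (is_derive_eq (is_derive1_comp (is_derive_sin _) d1)); rewrite mulrC.
  apply: is_derive_eq.
  by rewrite !scaler0 add0r /GRing.scale /= mulr1 mulKf.
have cF (x : R) : {for x, continuous F}.
  by apply: differentiable_continuous; apply/derivable1_diffP; case: (dF x).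
rewrite (@continuous_FTC2 _ _ F) ?ltr01 //.
- have -> : F 0 = 0 by rewrite /F !mulr0 sin0 mul0r mulr0 subrr.
  have -> : F 1 = c; last by rewrite sube0.
  rewrite /F !mulr1 (_ : 2 * pi = pi *+ 2) ?sin2pi; last by rewrite mulrC mulr_natr.
  by rewrite mul0r mulr0 subr0.
- apply: continuous_subspaceT => x; apply: cvgB; first exact: cvg_cst.
  apply: cvgM; first exact: cvg_cst.
  apply: (@continuous_comp _ _ _ (fun x => 2 * pi * x) cos); last exact: continuous_cos.
  by apply: cvgM; [exact: cvg_cst | exact: cvg_id].
- split.
  + by move=> x _; case: (dF x).
  + exact/cvg_at_right_filter/cF.
  + exact/cvg_at_left_filter/cF.
- by move=> x _; rewrite derive1E; case: (dF x).
Qed.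

Lemma fourier0_trace (lambda h : R) (s t : C) :
  fourier0 (fun x => \tr (monodromy_form lambda h s t x)) =
  coef_a lambda h s t + s * t / (lambda1 lambda h)%:C.
Proof.
set a := coef_a _ _ _ _; set b := s * t / _.
have tr x : \tr (monodromy_form lambda h s t x) =
    a - (2 * lambda1 lambda h * cos (2 * pi * x))%:C + b.
  by rewrite /mxtrace !big_ord_recl big_ord0 !mxE /= addr0.
rewrite /fourier0.
have -> : (fun x => Re (\tr (monodromy_form lambda h s t x))) =
    (fun x => Re a + Re b - 2 * lambda1 lambda h * cos (2 * pi * x)).
  by apply/funext => x; rewrite tr; case: a b {tr} => [a1 a2] [b1 b2] /=; ring.
have -> : (fun x => Im (\tr (monodromy_form lambda h s t x))) =
    (fun x => Im a + Im b - 0 * cos (2 * pi * x)).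
  by apply/funext => x; rewrite tr; case: a b {tr} => [a1 a2] [b1 b2] /=; ring.
by rewrite !integral_trigonometric; case: a b {tr} => [a1 a2] [b1 b2].
Qed.

End TraceCoefficient.

Section Estimates.
Variable R : realType.
Local Notation C := R[i].
Local Notation Re := (@complex.Re R).
Local Notation Im := (@complex.Im R).

(** For the last bound, with y = 1 + 8 l1 <= 9 and l = |L| / 2 >= sqrt y one has
    l^2 - l^2 / y = 8 l1 l^2 / y > 2 l1 l because 4 l >= 4 sqrt y > y. *)
Lemma gap_condition (l1 : R) (t L : C) : 0 < l1 ->
  (1 + 8 * l1)%:C * (1 + `|t| ^+ 2) <= (L / 2) ^+ 2 -> l1%:C <= `|t| <= 1 ->
  [/\ L = (Re L)%:C, 2 * l1 < `|Re L| &
      l1 * `|Re L| < Re L ^+ 2 / 4 - 1 - Im t ^+ 2].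
Proof.
move=> l0 H /andP[lt t1].
have l1le : l1 <= 1 by rewrite -(@lecR R); apply: le_trans lt t1.
have nt : `|t| ^+ 2 = (sqn t)%:C by rewrite norm_ReE -rmorphXn /= sqr_Re_norm.
move: H; rewrite nt; case: L => a b.
have -> : ((a +i* b) / 2) ^+ 2 = (a ^+ 2 / 4 - b ^+ 2 / 4) +i* (a * b / 2) :> C.
  have -> : (2 : C)^-1 = (2^-1)%:C by rewrite fmorphV rmorphMn rmorph1.
  by apply/eqP; rewrite eq_complex /=; apply/andP; split; apply/eqP; field.
have -> : (1 + 8 * l1)%:C * (1 + (sqn t)%:C) = ((1 + 8 * l1) * (1 + sqn t))%:C :> C.
  by apply/eqP; rewrite eq_complex /=; apply/andP; split; apply/eqP; ring.
rewrite lecE /= => /andP[/eqP ab le1].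
have st0 := sqn_ge0 t.
have y0 : 1 <= (1 + 8 * l1) * (1 + sqn t) by nra.
have b0 : b = 0.
  have : a * b = 0 by lra.
  move/eqP; rewrite mulf_eq0 => /orP[|] /eqP // a0; exfalso.
  by move: le1; rewrite a0 expr0n /=; have := sqr_ge0 b; lra.
rewrite b0 expr0n /= mul0r subr0 in le1.
split=> //; first by rewrite b0.
  rewrite -(ltr_pXn2r (n:=2)) ?nnegrE ?mulr_ge0 ?(ltW l0) //.
  by rewrite real_normK ?num_real //; nra.
set l := `|a|; have l_ge0 : 0 <= l by exact: normr_ge0.
have aa : a ^+ 2 = l ^+ 2 by rewrite /l real_normK ?num_real.
rewrite aa in le1 *.
have tI : Im t ^+ 2 <= sqn t by rewrite lerDr sqr_ge0.
set y := 1 + 8 * l1 in le1; set T := 1 + sqn t in le1.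
have yp : 0 < y by rewrite /y; lra.
have ly : y < 2 * l.
  rewrite ltNge; apply/negP => ly.
  have h1 : y <= l ^+ 2 / 4 by apply: le_trans le1; rewrite ler_peMr /y /T; lra.
  have h2 : (2 * l) ^+ 2 <= y ^+ 2 by rewrite ler_pXn2r ?nnegrE ?mulr_ge0 // ltW.
  have h3 : y * 16 <= y * y by rewrite expr2 in h2; lra.
  by move: h3; rewrite ler_pM2l // /y; lra.
have lp : 0 < l by lra.
suff : 0 < y * (l ^+ 2 / 4 - T - l1 * l).
  by rewrite pmulr_rgt0 // /T; lra.
have : 0 < l1 * l * (2 * l - y) by rewrite !mulr_gt0 // subr_gt0.
have -> : y * (l ^+ 2 / 4 - T - l1 * l) =
   l1 * l * (2 * l - y) + (l ^+ 2 / 4 - y * T) by rewrite /y; field.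
lra.
Qed.

End Estimates.

(** * The gap *)

Section Gap.
Variable R : realType.
Local Notation C := R[i].
Local Notation Re := (@complex.Re R).
Local Notation Im := (@complex.Im R).

Lemma cos_lipschitz (x y : R) : `|cos x - cos y| <= `|x - y|.
Proof.
wlog xy : x y / x <= y.
  move=> H; case: (leP x y) => [|/ltW]; first exact: H.
  by move=> /H; rewrite distrC [leRHS]distrC.
rewrite distrC [leRHS]distrC.
have [c _ ->] : exists2 c, c \in `[x, y] & cos y - cos x = - sin c * (y - x).
  apply: (@MVT_segment _ cos (fun z => - sin z)) => //.
  by apply: continuous_subspaceT => z; exact: continuous_cos.
by rewrite normrM normrN ler_piMl // ler_norml sin_geN1 sin_le1.
Qed.

Lemma continuousC_at_sE (lambda h : R) (F : minimal_family lambda h) (w : C) :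
  continuousC_at (BD F) w -> continuousC_at (DD F) w -> BD F w != 0 ->
  continuousC_at (sE F) w.
Proof.
move=> cB cD B0; rewrite /sE; apply: continuousC_atM; last exact: continuousC_atV.
by apply: continuousC_atM => //; exact: continuousC_at_cst.
Qed.

Lemma continuousC_at_tE (lambda h : R) (F : minimal_family lambda h) (w : C) :
  continuousC_at (AD F) w -> continuousC_at (tE F) w.
Proof. by move=> cA; apply: continuousC_atM => //; exact: continuousC_at_cst. Qed.

Lemma coef_LE (lambda h : R) (F : minimal_family lambda h) (w : C) :
  coef_L F w = coef_a lambda h (sE F w) (tE F w) +
     sE F w * tE F w / (lambda1 lambda h)%:C.
Proof. exact: fourier0_trace. Qed.

Lemma continuousC_at_coef_L (lambda h : R) (F : minimal_family lambda h) (w : C) :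
  continuousC_at (sE F) w -> continuousC_at (tE F) w -> sE F w != 0 -> tE F w != 0 ->
  continuousC_at (coef_L F) w.
Proof.
move=> cs ct s0 t0.
have -> : coef_L F = (fun w => coef_a lambda h (sE F w) (tE F w) +
     sE F w * tE F w / (lambda1 lambda h)%:C).
  by apply/funext => z; exact: coef_LE.
apply: continuousC_atD; last first.
  by apply: continuousC_atM; [exact: continuousC_atM | exact: continuousC_at_cst].
rewrite /coef_a; apply: continuousC_atM; last first.
  by apply: continuousC_atV; [rewrite mulf_neq0 | exact: continuousC_atM].
apply: continuousC_atM; first exact: continuousC_at_cst.
apply: continuousC_atD; last by apply: continuousC_atN; exact: continuousC_atX.
apply: continuousC_atD; first exact: continuousC_at_cst.
by apply: continuousC_atN; exact: continuousC_atX.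
Qed.

Definition regular_energy (lambda h : R) (F : minimal_family lambda h) (w : C) :=
  [/\ [/\ AD F w != 0, BD F w != 0, DD F w != 0 & W F w != 0],
      minimal_solution_D lambda h w (psiD F w) (AD F w) (BD F w) (DD F w),
      forall z, wronskian h (psiD F w) (Defs.reflect (psiD F w)) z = W F w,
      is_monodromy_matrix h (psiD F w) (monodromy_form lambda h (sE F w) (tE F w)) &
      [/\ continuousC_at (AD F) w, continuousC_at (BD F) w & continuousC_at (DD F) w]].

Lemma generically_and (P Q : C -> Prop) : generically P -> generically Q ->
  generically (fun w => P w /\ Q w).
Proof.
by move=> gP gQ p; have := gP p; have := gQ p; apply: filterS2 => w; split.
Qed.

Lemma generically_regular (lambda h : R) (F : minimal_family lambda h) :
  generically (regular_energy F).
Proof.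
have A := meromorphic_continuous (AD_mero F).
have B := meromorphic_continuous (BD_mero F).
have D := meromorphic_continuous (DD_mero F).
have := generically_and (generically_and (coefs_neq0 F) (psiD_minimal F))
  (generically_and (generically_and (psiD_wronskian F) (psiD_monodromy F))
    (generically_and A (generically_and B D))).
move=> H p; have := H p.
by apply: filterS => w [[? ?] [[? ?] [? [? ?]]]]; split.
Qed.

Section Interval.
Variables (lambda h : R) (F : minimal_family lambda h) (I : set R).
Hypotheses (lambda_gt0 : 0 < lambda) (h01 : 0 < h < 1) (openI : open I).
Hypothesis gapI : forall E : R, I E -> exists t L : R[i],
   [/\ mero_value (tE F) E%:C t, mero_value (coef_L F) E%:C L,
       (1 + 8 * lambda1 lambda h)%:C * (1 + `|t| ^+ 2) <= (L / 2) ^+ 2 &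
       (lambda1 lambda h)%:C <= `|t| <= 1].

Let pot (E x : R) := 2 * lambda * cos (2 * pi * x) - E.
Let A (E x : R) := fharper (fun n => pot E (x + n%:~R * h)).

Let l1_gt0 : 0 < lambda1 lambda h. Proof. exact: powR_gt0. Qed.

Lemma regular_fibre_bound E : I E -> regular_energy F E%:C ->
  exists2 d, 0 < d & forall x u, d * ip u u <= ip (A E x u) (A E x u).
Proof.
move=> IE [[A0 B0 D0 W0] [hol heq _] wr mon [cA cB cD]].
have l1C : (lambda1 lambda h)%:C != 0 :> C.
  by rewrite eq_complex /= eqxx andbT gt_eqF.
have t0 : tE F E%:C != 0 by rewrite /tE mulf_neq0 // oppr_eq0.
have s0 : sE F E%:C != 0.
  by rewrite /sE !mulf_neq0 ?invr_eq0 // oppr_eq0.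
have ct := continuousC_at_tE cA.
have cs := continuousC_at_sE cB cD B0.
have cL := continuousC_at_coef_L cs ct s0 t0.
have [t [L [/(mero_value_unique ct) -> /(mero_value_unique cL) -> H1 H2]]] := gapI IE.
have [LE L1 L2] := gap_condition l1_gt0 H1 H2.
apply: (energy_fibre_bound h01 l1_gt0 s0 t0 W0 hol heq wr mon _ L1 L2).
by rewrite -coef_LE -LE.
Qed.

(** The energies close to E other than E are regular, so only an isolated point
    has to be excluded. *)
Lemma gap_fibre_bound E : I E ->
  exists2 d, 0 < d & forall x u, d * ip u u <= ip (A E x u) (A E x u).
Proof.
move=> IE.
have [e1 e1_gt0 reg] := generically_real E (generically_regular F).
have [e2 e2_gt0 ball] : exists2 e2 : R, 0 < e2 & forall E', `|E' - E| < e2 -> I E'.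
  have /nbhs_ballP[e2 /= e20 H] : nbhs E I by exact: open_nbhs_nbhs.
  by exists e2 => // E' E'e; apply: H; rewrite /ball /= distrC.
set M := `|2 * lambda| + `|E|.
apply: (@isolated_fibre _ (pot E) h M (`|2 * lambda| * (2 * pi)) (Num.min e1 e2)).
- exact: harper_potential_bound.
- by rewrite !mulr_gt0 ?pi_gt0 // normr_gt0 mulf_neq0 // gt_eqF.
- move=> x y; rewrite /pot opprB addrA subrK -mulrBr normrM -[leRHS]mulrA.
  apply: ler_wpM2l => //; apply: le_trans (cos_lipschitz _ _) _.
  by rewrite -mulrBr normrM gtr0_norm // mulr_gt0 // pi_gt0.
- by move=> x k; rewrite /pot cos_periodic_int.
- by rewrite lt_min e1_gt0.
move=> x e /andP[e0]; rewrite lt_min => /andP[ee1 ee2].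
have IE' : I (E + e) by apply: ball; rewrite addrC addKr.
have regE : regular_energy F (E + e)%:C.
  by apply: reg; rewrite addrC addKr e0.
have [d d0 dP] := regular_fibre_bound IE' regE.
exists d => // u; have := dP x u.
have -> // : A (E + e) x u = fharper (fun n => pot E (x + n%:~R * h)) u - e *: u.
by apply: fseq_eq => n; rewrite fseqD fseqN fseqZ !fharperE /pot; ring.
Qed.

End Interval.
End Gap.

Unset Implicit Arguments.

Theorem theorem2p4 (R : realType) (lambda : R) (lambda_gt0 : 0 < lambda)
    (I : set R) (I_open_interval : open_interval I) :
  exists C : R,
    forall (h : R) (F : minimal_family lambda h), 0 < h < 1 ->
      (forall E : R, I E -> exists t L : R[i],
         [/\ mero_value (tE F) E%:C t,
             mero_value (coef_L F) E%:C L,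
             (1 + C * lambda1 lambda h)%:C * (1 + `|t| ^+ 2) <= (L / 2) ^+ 2 &
             (lambda1 lambda h)%:C <= `|t| <= 1]) ->
      in_gap (harper_op lambda h) I.
Proof.
exists 8 => h F h01 gapI; have [openI _] := I_open_interval.
exists I; split=> // E IE; apply.
have [d d_gt0 dP] := gap_fibre_bound lambda_gt0 h01 openI gapI IE.
exact: fibre_bound_resolvent d_gt0 dP.
Qed.
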